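(* Let $G_1$ be a finite simple connected graph and $G_2$ a finite simple connected bipartite graph, with $h^*$-polynomials $H_1(t)$ and $H_2(t)$ of $\mathcal{P}_{G_1}$ and $\mathcal{P}_{G_2}$. Let $G$ be the graph obtained from the disjoint union of $G_1$ and $G_2$ by identifying an edge of $G_1$ with an edge of $G_2$. Then the $h^*$-polynomial of $\mathcal{P}_G$ equals $\frac{H_1(t)H_2(t)}{1+t}$. In particular, if $H_1$ and $H_2$ have only real roots, then so does the $h^*$-polynomial of $\mathcal{P}_G$.
   Context: For a graph $H=(V,E)$, $\mathcal{P}_H:=\mathrm{conv}\{\mathbf{e}_v-\mathbf{e}_w,\ \mathbf{e}_w-\mathbf{e}_v : \{v,w\}\in E\}\subset\mathbb{R}^V$; for connected $H$ it is a lattice polytope of dimension $d=|V|-1$. Its $h^*$-polynomial $h^*(t)$ is defined by $\sum_{j\ge0}|j\mathcal{P}_H\cap\mathbb{Z}^V|\,t^j=\frac{h^*(t)}{(1-t)^{d+1}}$. Identifying edges $\{v,w\}$ and $\{v',w'\}$ means identifying $v$ with $v'$, $w$ with $w'$ and the two edges. *)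

(* Defs.v *)
From HB Require Import structures.
From mathcomp Require Import all_boot all_order all_algebra finmap.
From mathcomp Require Import all_classical reals.
From mathcomp Require Import complex.

Set Implicit Arguments.
Unset Strict Implicit.
Unset Printing Implicit Defensive.

Import Order.TTheory GRing.Theory Num.Theory.
Local Open Scope classical_set_scope.
Local Open Scope ring_scope.

(** * Finite simple graphs *)

Record sgraph := SGraph {
  vertex :> finType;
  adj : rel vertex;
  adj_sym : symmetric adj;
  adj_irr : irreflexive adj }.

Definition sgraph_connected (G : sgraph) : Prop :=
  forall x y : G, connect (@adj G) x y.

Definition sgraph_bipartite (G : sgraph) : Prop :=
  exists c : G -> bool, forall x y : G, adj x y -> c x != c y.

(** * Identification of an edge *)

Definition sum_adj (G1 G2 : sgraph) (x y : G1 + G2) : bool :=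
  match x, y with
  | inl a, inl b => adj a b
  | inr a, inr b => adj a b
  | _, _ => false
  end.

(* The equivalence relation on the disjoint union generated by v1 ~ v2 and
   w1 ~ w2, when v1 != w1 and v2 != w2. *)
Definition edge_ident (G1 G2 : sgraph) (v1 w1 : G1) (v2 w2 : G2)
    (x y : G1 + G2) : bool :=
  match x, y with
  | inl a, inl b => a == b
  | inr a, inr b => a == b
  | inl a, inr b | inr b, inl a =>
      ((a == v1) && (b == v2)) || ((a == w1) && (b == w2))
  end.

(* G is the quotient of the disjoint union of G1 and G2, with projection pi. *)
Definition edge_gluing (G1 G2 G : sgraph) (v1 w1 : G1) (v2 w2 : G2)
    (pi : G1 + G2 -> G) : Prop :=
  [/\ forall a : G, exists x, pi x = a,
      forall x y, pi x = pi y <-> edge_ident v1 w1 v2 w2 x y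
    & forall a b : G,
        adj a b <-> exists x y, [/\ pi x = a, pi y = b & sum_adj x y]].

Lemma edge_gluing_exists (G1 G2 : sgraph) (v1 w1 : G1) (v2 w2 : G2) :
  adj v1 w1 -> adj v2 w2 ->
  exists (G : sgraph) (pi : G1 + G2 -> G), edge_gluing v1 w1 v2 w2 pi.
Proof.
move=> e1 e2.
have nvw1 : v1 != w1 by apply: contraTneq e1 => ->; rewrite adj_irr.
have nvw2 : v2 != w2 by apply: contraTneq e2 => ->; rewrite adj_irr.
pose Q : pred (G1 + G2) := fun x => (x != inr v2) && (x != inr w2).
pose rep (x : G1 + G2) : G1 + G2 :=
  if x == inr v2 then inl v1 else if x == inr w2 then inl w1 else x.
have repQ x : Q (rep x).
  rewrite /rep; case: (eqVneq x (inr v2)) => // n1.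
  by case: (eqVneq x (inr w2)) => // n2; rewrite /Q n1 n2.
pose V : finType := {x : G1 + G2 | Q x}.
pose pi x : V := exist _ (rep x) (repQ x).
have piE x y : pi x = pi y <-> edge_ident v1 w1 v2 w2 x y.
  transitivity (rep x = rep y).
    by split=> [/(congr1 val)//|h]; apply: val_inj.
  rewrite /rep /edge_ident.
  have inrE (a b : G2) : (@inr G1 G2 a == inr b) = (a == b) by [].
  case: x y => [a|a] [b|b] /=; rewrite ?inrE.
  - by split=> [[->]//|/eqP->].
  - case: (eqVneq b v2) => [->|nb].
      rewrite (negPf nvw2) andbF orbF andbT.
      by split=> [[->]//|/eqP->].
    case: (eqVneq b w2) => [_|nb']; rewrite ?andbF ?andbT //=.
    by split=> [[->]//|/eqP->].
  - case: (eqVneq a v2) => [->|na].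
      rewrite (negPf nvw2) andbF orbF andbT.
      by split=> [[->]//|/eqP->].
    case: (eqVneq a w2) => [_|na']; rewrite ?andbF ?andbT //=.
    by split=> [[->]//|/eqP->].
  - case: (eqVneq a b) => [->|nab]; first by split.
    split=> //.
    case: (eqVneq a v2) => [ea|_]; case: (eqVneq b v2) => [eb|_].
    + by rewrite ea eb eqxx in nab.
    + by case: (eqVneq b w2) => [_|_] // [h]; rewrite h eqxx in nvw1.
    + by case: (eqVneq a w2) => [_|_] // [h]; rewrite h eqxx in nvw1.
    + case: (eqVneq a w2) => [ea|_]; case: (eqVneq b w2) => [eb|_] //.
      * by rewrite ea eb eqxx in nab.
      * by case=> h; rewrite h eqxx in nab.
pose e : rel V := fun a b =>
  [exists x, [exists y, [&& pi x == a, pi y == b & sum_adj x y]]].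
have eP a b : e a b <-> exists x y, [/\ pi x = a, pi y = b & sum_adj x y].
  split=> [/existsP[x /existsP[y /and3P[/eqP ? /eqP ? ?]]]|]; first by exists x, y.
  by case=> x [y [<- <- h]]; apply/existsP; exists x; apply/existsP; exists y;
    rewrite !eqxx.
have sumC : symmetric (@sum_adj G1 G2).
  by case=> a [] b //=; rewrite adj_sym.
have e_sym : symmetric e.
  by move=> a b; apply/idP/idP => /(proj1 (eP _ _))[x [y [xa yb h]]];
    apply/(proj2 (eP _ _)); exists y, x; rewrite sumC.
have eirr : irreflexive e.
  move=> a; apply/negbTE/negP => /(proj1 (eP _ _))[x [y [<- /esym/(proj1 (piE _ _))]]].
  by case: x y => [x|x] [y|y] //= /eqP ->; rewrite adj_irr.
exists (SGraph e_sym eirr), pi; split => // a.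
exists (val a); apply: val_inj => /=; rewrite /rep.
by have /andP[/negPf -> /negPf ->] := valP a.
Qed.

(** * Symmetric edge polytopes *)

Definition conv_hull (R : realType) (V : finType) (S : set {ffun V -> R}) :
    set {ffun V -> R} :=
  [set x | exists (n : nat) (p : 'I_n -> {ffun V -> R}) (a : 'I_n -> R),
    [/\ forall i, S (p i), forall i, 0 <= a i, \sum_i a i = 1
      & x = [ffun v => \sum_i a i * p i v]]].

Definition unit_vec (R : realType) (V : finType) (v : V) : {ffun V -> R} :=
  [ffun u => (u == v)%:R].

(* As adj is symmetric, the generators include both e_v - e_w and e_w - e_v. *)
Definition sym_edge_polytope (R : realType) (G : sgraph) : set {ffun G -> R} :=
  conv_hull [set x | exists v w : G, adj v w /\ x = unit_vec R v - unit_vec R w].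
Arguments sym_edge_polytope : clear implicits.

(** * Ehrhart series and h*-polynomials *)

Definition int_lattice (R : realType) (V : finType) : set {ffun V -> R} :=
  [set x | forall v, x v \is a Num.int].
Arguments int_lattice : clear implicits.

Definition dilate_points (R : realType) (V : finType) (P : set {ffun V -> R})
    (j : nat) : set {ffun V -> R} :=
  [set [ffun v => j%:R * x v] | x in P] `&` int_lattice R V.

(* fset_set A is the finite set A only when A is finite;
   see finite_sym_edge_points. *)
Definition ehrhart (R : realType) (V : finType) (P : set {ffun V -> R})
    (j : nat) : nat :=
  #|` fset_set (dilate_points P j)|.

(* h(t) = (1 - t)^(d+1) * \sum_j ehrhart P j t^j as formal power series. *)
Definition is_hstar (R : realType) (V : finType) (P : set {ffun V -> R})
    (d : nat) (h : {poly R}) : Prop :=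
  forall n : nat,
    h`_n = \sum_(i < n.+1) ((1 - 'X) ^+ d.+1 : {poly R})`_i
                           * (ehrhart P (n - i))%:R.

(* For G connected the dimension of sym_edge_polytope R G is #|G| - 1. *)
Definition is_sep_hstar (R : realType) (G : sgraph) (h : {poly R}) : Prop :=
  is_hstar (sym_edge_polytope R G) #|G|.-1 h.

Definition real_rooted (R : realType) (p : {poly R}) : Prop :=
  forall z : R[i], root (map_poly (real_complex R) p) z -> complex.Im z = 0.

Lemma finite_sym_edge_points (R : realType) (G : sgraph) (j : nat) :
  finite_set (dilate_points (sym_edge_polytope R G) j).
Proof.
pose f (k : {ffun G -> 'I_(j + j).+1}) : {ffun G -> R} :=
  [ffun v => (k v)%:R - j%:R].
apply: (@sub_finite_set _ _ (range f)); last first.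
  exact/finite_image/finite_finset.
move=> _ [[_ [n [p [a [pS a0 a1 ->]]]] <-] xint].
have pb i v : `|p i v| <= 1.
  have [s [t [_ ->]]] := pS i; rewrite !ffunE.
  by case: eqP; case: eqP; rewrite ?subrr ?subr0 ?sub0r ?normrN ?normr1 ?normr0.
move: xint; set x := finfun _ => xint.
have xb v : `|x v| <= j%:R.
  rewrite !ffunE normrM ger0_norm // ler_piMr // -a1.
  apply: le_trans (ler_norm_sum _ _ _) _; apply: ler_sum => i _.
  by rewrite normrM ger0_norm // ler_piMr.
exists [ffun v => inord `|Num.floor (x v + j%:R)|%N] => //.
apply/ffunP => v; rewrite [LHS]ffunE [in LHS]ffunE.
have /intrP[m xm] := xint v.
have := xb v; rewrite xm ler_norml => /andP[lo hi].
have -> : m%:~R + j%:R = (m + j%:Z)%:~R :> R by rewrite intrD.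
rewrite intrKfloor.
have m0 : 0 <= m + j%:Z.
  by rewrite -(ler_int R) intrD /= -lerBlDr sub0r.
have mj : m + j%:Z <= (j + j)%N.
  by rewrite PoszD lerD2r -(ler_int R).
rewrite inordK; last by rewrite ltnS -lez_nat gez0_abs.
rewrite [X in X - _](_ : _ = (m + j%:Z)%:~R); last by rewrite -[in RHS](gez0_abs m0).
by rewrite intrD addrK.
Qed.

(* Main.v *)
Require Import Defs.
From HB Require Import structures.
From mathcomp Require Import all_boot all_order all_algebra finmap.
From mathcomp Require Import all_classical reals.
From mathcomp Require Import complex.
From mathcomp Require Import zify ring.
Import Order.TTheory GRing.Theory Num.Theory.
Local Open Scope ring_scope.

Set Implicit Arguments.
Unset Strict Implicit.
Unset Printing Implicit Defensive.

(* For an integer vector x in the lattice spanned by the edge vectors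
   e_v - e_w, let N(x) be the least number of edge vectors with sum x. Rounding
   real flows (total unimodularity) shows that j P_G contains x iff N(x) <= j,
   so that h*_G(t) = (1 - t)^d A_G(t) with A_G(t) = \sum_x t^N(x).

   Let b be the edge vector of the glued edge. If G_2 is bipartite, N_2(x + b)
   and N_2(x) have different parities, and k |-> N_2(x + k b) is convex and
   1-Lipschitz; hence each coset x + Z b has a unique minimiser y, and
   N_2(y + k b) = N_2(y) + |k|. Writing B for the generating function of these
   "reduced" y, this gives A_2 = B (1 + t) / (1 - t). Every lattice vector of G is
   uniquely x_1 + y with y reduced, and then N(x_1 + y) = N_1(x_1) + N_2(y), so
   A_G = A_1 B and (1 + t) h*_G = H_1 H_2 as power series.

   For divisibility in the polynomial ring it remains to see that
   (1 - t)^m A_G is a polynomial for some m. Each x has a flow that is minimal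
   for the size and then lexicographically, together with all its multiples;
   whether a flow is of this kind depends only on its support, so A_G is a sum
   of terms (t / (1 - t))^|S|. *)

(** * Rounding of flows *)

(** On a loop the two indicators cancel, so [inc e] vanishes; this is why loops are excluded in the
    rounding arguments. *)
Definition inc (V : finType) (e : V * V) (v : V) : int :=
  (v == e.1)%:R - (v == e.2)%:R.

Lemma inc_eq0 (V : finType) (e : V * V) v :
  v != e.1 -> v != e.2 -> inc e v = 0.
Proof. by rewrite /inc => /negPf-> /negPf->. Qed.

Lemma inc_unit (V : finType) (e : V * V) v :
  inc e v != 0 -> inc e v = 1 \/ inc e v = -1.
Proof. by rewrite /inc; case: (v == e.1); case: (v == e.2) => // _; [left|right]. Qed.

Lemma sum_inc (V : finType) (e : V * V) (P : pred V) :
  P e.1 -> P e.2 -> \sum_(v | P v) inc e v = 0.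
Proof.
move=> P1 P2; rewrite /inc sumrB.
have sum1 a : P a -> \sum_(v | P v) (v == a)%:R = 1 :> int.
  move=> Pa; rewrite (bigD1 a) //= eqxx big1 ?addr0 // => v /andP[_ /negPf->].
  by [].
by rewrite !sum1 // subrr.
Qed.

(* Every vertex met by [S] has degree at least 2 in [S], so [S] has at least as
   many edges as vertices, while the incidence vectors of [S] lie in the
   sum-zero hyperplane. *)
Lemma incidence_dependent (R : realFieldType) (V : finType) (S : {set V * V}) :
  S != finset.set0 -> (forall e, e \in S -> e.1 != e.2) ->
  (forall e v, e \in S -> inc e v != 0 ->
     exists2 e', e' \in S & (e' != e) && (inc e' v != 0)) ->
  exists g : V * V -> R,
    [/\ exists e, g e != 0, forall e, e \notin S -> g e = 0
      & forall v, \sum_e g e * (inc e v)%:~R = 0].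
Proof.
move=> /set0Pn[e0 e0S] nl deg2.
pose W := [set v : V | [exists e in S, inc e v != 0]]%SET.
have WP e v : e \in S -> inc e v != 0 -> v \in W.
  by move=> eS ev; rewrite inE; apply/existsP; exists e; rewrite eS.
have inc1 (e : V * V) : e.1 != e.2 -> inc e e.1 != 0.
  by rewrite /inc eqxx => /negPf->; rewrite subr0.
have inc2 (e : V * V) : e.1 != e.2 -> inc e e.2 != 0.
  by rewrite eq_sym /inc eqxx => /negPf->; rewrite sub0r oppr_eq0.
(* Double counting of incidences: every vertex of [W] lies on at least two edges of [S], and every
   edge has at most two endpoints. *)
have leWS : (#|W| <= #|S|)%N.
  rewrite -(leq_pmul2r (isT : (0 < 2)%N)).
  pose D := (\sum_(v in W) \sum_(e in S) (inc e v != 0)%:R)%N.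
  apply: (@leq_trans D).
    rewrite -sum_nat_const; apply: leq_sum => v; rewrite inE.
    case/existsP=> e /andP[eS ev].
    have [e' e'S /andP[ne e'v]] := deg2 _ _ eS ev.
    rewrite (bigD1 e) //= (bigD1 e') /=; last by rewrite e'S.
    by rewrite ev e'v.
  rewrite /D exchange_big /= -sum_nat_const; apply: leq_sum => e eS.
  apply: (@leq_trans (\sum_(v in W) ((v == e.1) + (v == e.2)))%N).
    apply: leq_sum => v _.
    by have [->|n1] := eqVneq v e.1; [case: (inc _ _ != 0)|
       have [->|n2] := eqVneq v e.2; [case: (inc _ _ != 0)|rewrite inc_eq0 ?eqxx]].
  rewrite big_split /=.
  have h a : (\sum_(v in W) (v == a) <= 1)%N.
    have [aW|aW] := boolP (a \in W).
      by rewrite (bigD1 a) //= eqxx big1 // => v /andP[_ /negPf->].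
    by rewrite big1 // => v vW; case: eqP => // va; rewrite -va vW in aW.
  by rewrite (leq_add (h _) (h _)).
pose M : 'M[R]_(#|S|, #|W|) :=
  \matrix_(i, j) (inc (enum_val i) (enum_val j))%:~R.
(* The all-ones column is killed by [M], so the rank is below [#|W|], hence below [#|S|], and the
   rows are dependent. *)
have M1 : M *m const_mx 1 = 0 :> 'cV_#|S|.
  apply/matrixP => i j; rewrite !mxE.
  under eq_bigr do rewrite !mxE mulr1.
  rewrite -(big_enum_val (fun v => (inc (enum_val i) v)%:~R)) /=.
  have iS := enum_valP i.
  by rewrite -rmorph_sum sum_inc //=; 
    apply: (WP (enum_val i) _ iS); [apply: inc1|apply: inc2]; apply: nl.
have W0 : (0 < #|W|)%N.
  by apply/card_gt0P; exists e0.1; apply: (WP _ _ e0S); apply/inc1/nl.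
have rkM : (\rank M < #|S|)%N.
  apply: leq_trans leWS; rewrite ltn_neqAle rank_leq_col andbT.
  apply/negP => /row_fullP[B BM].
  have : B *m M *m (const_mx 1 : 'cV_#|W|) = 0 by rewrite -mulmxA M1 mulmx0.
  rewrite BM mul1mx => /matrixP/(_ (Ordinal W0) 0); rewrite !mxE => /eqP.
  by rewrite oner_eq0.
have : kermx M != 0 by rewrite kermx_eq0 /row_free neq_ltn rkM.
case/rowV0Pn => r /sub_kermxP rM r0.
pose g e := \sum_i r 0 i *+ (enum_val i == e).
have gE i : g (enum_val i) = r 0 i.
  rewrite /g (bigD1 i) //= eqxx big1 ?addr0 // => j /negPf ji.
  by rewrite (inj_eq enum_val_inj) ji.
exists g; split.
- have /rV0Pn[i ri] := r0; by exists (enum_val i); rewrite gE.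
- move=> e eS; rewrite /g big1 // => i _; case: eqP => // ie.
  by rewrite -ie enum_valP in eS.
- move=> v; rewrite (bigID (mem S)) /= [X in _ + X]big1 ?addr0; last first.
    move=> e eS; rewrite /g big1 ?mul0r // => i _; case: eqP => // ie.
    by rewrite -ie enum_valP in eS.
  have [vW|vW] := boolP (v \in W); last first.
    apply: big1 => e eS; have [->|ev] := eqVneq (inc e v) 0; first by rewrite mulr0.
    by rewrite (WP e) in vW.
  move/matrixP: rM => /(_ 0 (enum_rank_in vW v)); rewrite !mxE => rM.
  rewrite -[RHS]rM (big_enum_val (fun e => g e * (inc e v)%:~R)).
  by apply: eq_bigr => i _; rewrite gE mxE enum_rankK_in.
Qed.

(** Induction on the number of fractional entries. The edges carrying them support a nonzero
    circulation by [incidence_dependent]. Pushing [f] along it, in a direction that does not raise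
    the cost, until some entry becomes integral leaves fewer fractional entries. *)
Lemma flow_rounding (R : archiRealFieldType) (V : finType) (c : V * V -> R)
    (l u : V * V -> int) (f : V * V -> R) :
  (forall e, (l e)%:~R <= f e <= (u e)%:~R) ->
  (forall v, \sum_e f e * (inc e v)%:~R \is a Num.int) ->
  (forall e, f e \isn't a Num.int -> e.1 != e.2) ->
  exists g : V * V -> int,
    [/\ forall e, l e <= g e <= u e,
        forall v, \sum_e f e * (inc e v)%:~R = (\sum_e g e * inc e v)%:~R
      & \sum_e c e * (g e)%:~R <= \sum_e c e * f e].
Proof.
have [n] := ubnP #|[set e | f e \isn't a Num.int]%SET|.
elim: n f => // n IHn f; rewrite ltnS => leSn lfu fint fnl.
set S := [set e | _]%SET in leSn.
have [S0|S0] := eqVneq S finset.set0.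
  have fZ e : f e = (Num.floor (f e))%:~R.
    apply/esym/eqP; rewrite -intrEfloor.
    by apply: contraT => fe; have := finset.in_set0 e; rewrite -S0 inE fe.
  exists (fun e => Num.floor (f e)); split=> [e|v|].
  - by have := lfu e; rewrite fZ !ler_int intrKfloor.
  - by rewrite rmorph_sum /=; apply: eq_bigr => e _; rewrite intrM -fZ.
  - by under eq_bigr do rewrite -fZ.
have [||h [[e1 he1] hS hbd]] := @incidence_dependent R V S S0.
- by move=> e; rewrite inE => /fnl.
(* If [e] were the only fractional edge at [v], integrality of the sum at [v] would make [f e]
   integral. *)
- move=> e v eS ev; apply/exists_inP; apply: contraT.
  rewrite negb_exists_in => /forall_inP nS.
  have := fint v; rewrite (bigD1 e) //= rpredDr; last first.
    apply: rpred_sum => e' e'e; have [e'S|] := boolP (e' \in S).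
      by have := nS _ e'S; rewrite e'e /= negbK => /eqP ->; rewrite mulr0 rpred0.
    by rewrite inE negbK => fe'; rewrite rpredM // intr_int.
  move: eS; rewrite inE => /negPf fe.
  by case: (inc_unit ev) => ->; rewrite ?mulrN ?rpredN mulr1 fe.
(* Either [h] or its negative does not increase the cost. *)
have [g [[e2 ge2] gS gbd gc]] : exists g : V * V -> R,
   [/\ exists e, g e != 0, forall e, e \notin S -> g e = 0,
       forall v, \sum_e g e * (inc e v)%:~R = 0 & \sum_e c e * g e <= 0].
  have [c0|c0] := lerP (\sum_e c e * h e) 0.
    by exists h; split => //; exists e1.
  exists (fun e => - h e); split.
  - by exists e1; rewrite oppr_eq0.
  - by move=> e /hS ->; rewrite oppr0.
  - by move=> v; under eq_bigr do rewrite mulNr; rewrite sumrN hbd oppr0.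
  - by under eq_bigr do rewrite mulrN; rewrite sumrN oppr_le0 ltW.
(* [tau e] is the time at which [f e + t * g e] reaches the next integer in the direction of the
   sign of [g e]; the smallest such time is taken as the step. *)
pose tau e := (if 0 < g e then (Num.floor (f e))%:~R + 1 - f e
               else (Num.floor (f e))%:~R - f e) / g e.
have gnS e : g e != 0 -> e \in S by move=> ge; apply: contraNT ge => /gS ->.
have floorS e : e \in S -> (Num.floor (f e))%:~R < f e < (Num.floor (f e))%:~R + 1.
  rewrite inE => fe; have /andP[lo hi] := floor_itv (f e).
  by rewrite lt_neqAle lo -intrEfloor fe -[1]/(1%:~R) -intrD hi.
have tau0 e : g e != 0 -> 0 < tau e.
  move=> ge; have /andP[lo hi] := floorS _ (gnS _ ge).
  rewrite /tau; case: (ltrgt0P (g e)) ge => // gp _.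
    by rewrite divr_gt0 // subr_gt0.
  by rewrite nmulr_rgt0 ?invr_lt0 // subr_lt0.
have [e3 ge3 tmin] := arg_minP (i0 := e2) (P := fun e => g e != 0) tau ge2.
set t := tau e3.
have t0 : 0 < t by apply: tau0.
pose f' e := f e + t * g e.
have f'E e : g e = 0 -> f' e = f e by rewrite /f' => ->; rewrite mulr0 addr0.
(* By minimality of [t] no entry crosses an integer, so the integral bounds [l] and [u] survive. *)
have f'floor e : g e != 0 ->
    (Num.floor (f e))%:~R <= f' e <= (Num.floor (f e))%:~R + 1.
  move=> ge; have /andP[lo hi] := floorS _ (gnS _ ge).
  have := tmin e ge; rewrite -/t /tau /f'; case: (ltrgt0P (g e)) ge => // gp _.
    rewrite ler_pdivlMr // => tg; apply/andP; split.
      by rewrite (le_trans (ltW lo)) // lerDl mulr_ge0 // ltW.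
    by rewrite -lerBrDl.
  rewrite ler_ndivlMr // => tg; apply/andP; split.
    by rewrite -lerBlDl.
  by rewrite (le_trans _ (ltW hi)) // gerDl nmulr_lle0 // ltW.
have f'lu e : (l e)%:~R <= f' e <= (u e)%:~R.
  have [/f'E ->|ge] := eqVneq (g e) 0; first exact: lfu.
  have /andP[lo hi] := floorS _ (gnS _ ge).
  have /andP[lo' hi'] := f'floor _ ge; have /andP[lf fu] := lfu e.
  apply/andP; split.
    by apply: le_trans lo'; rewrite ler_int floor_ge_int.
  apply: le_trans hi' _; rewrite -[1]/(1%:~R) -intrD ler_int lezD1.
  by rewrite -(ltr_int R) (lt_le_trans lo).
have f'bd v : \sum_e f' e * (inc e v)%:~R = \sum_e f e * (inc e v)%:~R.
  rewrite /f'; under eq_bigr do rewrite mulrDl -mulrA.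
  by rewrite big_split /= -mulr_sumr gbd mulr0 addr0.
have f'c : \sum_e c e * f' e <= \sum_e c e * f e.
  rewrite /f'; under eq_bigr do rewrite mulrDr mulrCA.
  by rewrite big_split /= -mulr_sumr gerDl pmulr_rle0.
have f'S e : f' e \isn't a Num.int -> e \in S.
  by have [/f'E->|/gnS ->//] := eqVneq (g e) 0; rewrite inE.
have f'3 : f' e3 \is a Num.int.
  rewrite /f' /t /tau divfK //; case: ifP => _;
    by rewrite addrC subrK ?rpredD ?intr_int ?rpred1.
have [||||k [k1 k2 k3]] := IHn f'.
- apply: leq_trans leSn; apply: proper_card; apply/properP; split.
    by apply/fintype.subsetP => e; rewrite inE => /f'S.
  exists e3; first exact: gnS.
  by rewrite inE; apply/negPn; exact: f'3.
- by [].
- by move=> v; rewrite f'bd.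
- by move=> e /f'S; rewrite inE; apply: fnl.
exists k; split=> // [v|]; first by rewrite -k2 f'bd.
exact: le_trans k3 f'c.
Qed.

(** * The word norm *)

Definition edge_vec (V : finType) (e : V * V) : {ffun V -> int} :=
  [ffun v => inc e v].

Definition word_sum (V : finType) (s : seq (V * V)) : {ffun V -> int} :=
  \sum_(e <- s) edge_vec e.

Definition edge_word (G : sgraph) (s : seq (G * G)) : bool :=
  all (fun e => adj e.1 e.2) s.

(** Positive words suffice to give a subgroup: [adj] is symmetric, so the reversed edge supplies the
    negative of an edge vector. *)
Definition edge_lattice (G : sgraph) : set {ffun G -> int} :=
  fun x => exists2 s : seq (G * G), edge_word s & word_sum s = x.
Arguments edge_lattice : clear implicits.

Definition word_lengths (G : sgraph) (x : {ffun G -> int}) : pred nat :=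
  fun n => `[< exists s : seq (G * G),
                 [/\ edge_word s, word_sum s = x & size s = n] >].

(* Junk value [0] outside [edge_lattice G]. *)
Definition word_norm (G : sgraph) (x : {ffun G -> int}) : nat :=
  if pselect (exists n, word_lengths x n) is left ex then ex_minn ex else 0%N.
Arguments word_norm {G} x%_ring_scope.

Lemma word_sum_cat (V : finType) (s t : seq (V * V)) :
  word_sum (s ++ t) = word_sum s + word_sum t.
Proof. by rewrite /word_sum big_cat. Qed.

Lemma word_sum_cons (V : finType) e (s : seq (V * V)) :
  word_sum (e :: s) = edge_vec e + word_sum s.
Proof. by rewrite /word_sum big_cons. Qed.

Lemma word_sum_nil (V : finType) : word_sum [::] = 0 :> {ffun V -> int}.
Proof. by rewrite /word_sum big_nil. Qed.

Lemma edge_vec_swap (V : finType) (e : V * V) :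
  edge_vec (e.2, e.1) = - edge_vec e.
Proof. by apply/ffunP => v; rewrite !ffunE /inc opprB. Qed.

Lemma word_sum_swap (V : finType) (s : seq (V * V)) :
  word_sum [seq (e.2, e.1) | e <- s] = - word_sum s.
Proof.
rewrite /word_sum big_map -sumrN; apply: eq_bigr => e _.
exact: edge_vec_swap.
Qed.

Section WordNorm.
Variable G : sgraph.
Implicit Types (x y : {ffun G -> int}) (s : seq (G * G)) (e : G * G).

Lemma edge_word_swap s :
  edge_word [seq (e.2, e.1) | e <- s] = edge_word s.
Proof. by rewrite /edge_word all_map; apply: eq_all => e /=; rewrite adj_sym. Qed.

Lemma word_normP x : edge_lattice G x ->
  exists s, [/\ edge_word s, word_sum s = x & size s = word_norm x].
Proof.
case=> s sw sx; rewrite /word_norm; case: pselect => [ex|[]]; last first.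
  by exists (size s); apply/asboolP; exists s.
by case: ex_minnP => n /asboolP.
Qed.

Lemma word_norm_le s : edge_word s -> (word_norm (word_sum s) <= size s)%N.
Proof.
move=> sw; rewrite /word_norm; case: pselect => [ex|[]]; last first.
  by exists (size s); apply/asboolP; exists s.
by case: ex_minnP => n _; apply; apply/asboolP; exists s.
Qed.

Lemma edge_lattice_word s : edge_word s -> edge_lattice G (word_sum s).
Proof. by move=> sw; exists s. Qed.

Lemma edge_latticeD x y :
  edge_lattice G x -> edge_lattice G y -> edge_lattice G (x + y).
Proof.
move=> [s sw <-] [t tw <-]; exists (s ++ t); last exact: word_sum_cat.
by rewrite /edge_word all_cat; apply/andP.
Qed.

Lemma edge_latticeN x : edge_lattice G x -> edge_lattice G (- x).
Proof.
move=> [s sw <-]; exists [seq (e.2, e.1) | e <- s]; first by rewrite edge_word_swap.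
exact: word_sum_swap.
Qed.

Lemma edge_lattice0 : edge_lattice G 0.
Proof. by exists [::] => //; rewrite word_sum_nil. Qed.

Lemma edge_lattice_edge e : adj e.1 e.2 -> edge_lattice G (edge_vec e).
Proof.
by move=> h; exists [:: e]; rewrite /edge_word /= ?h // word_sum_cons word_sum_nil addr0.
Qed.

Lemma edge_latticeMz x (k : int) : edge_lattice G x -> edge_lattice G (x *~ k).
Proof.
move=> xl; have nl (n : nat) : edge_lattice G (x *+ n).
  elim: n => [|n IH]; first exact: edge_lattice0.
  by rewrite mulrS; apply: edge_latticeD.
by case: k => n; [apply: nl|apply: edge_latticeN; apply: nl].
Qed.

Lemma edge_lattice_sum0 x : edge_lattice G x -> \sum_v x v = 0.
Proof.
case=> s _ <-; elim: s => [|e s IH].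
  by rewrite word_sum_nil big1 // => v _; rewrite ffunE.
rewrite word_sum_cons; under eq_bigr do rewrite !ffunE.
by rewrite big_split /= IH sum_inc.
Qed.

Lemma word_normD x y : edge_lattice G x -> edge_lattice G y ->
  (word_norm (x + y) <= word_norm x + word_norm y)%N.
Proof.
move=> /word_normP[s [sw sx <-]] /word_normP[t [tw ty <-]].
rewrite -sx -ty -word_sum_cat -size_cat; apply: word_norm_le.
by rewrite /edge_word all_cat; apply/andP.
Qed.

Lemma word_normN x : edge_lattice G x -> word_norm (- x) = word_norm x.
Proof.
have le y : edge_lattice G y -> (word_norm (- y) <= word_norm y)%N.
  move=> /word_normP[s [sw sx <-]].
  rewrite -sx -word_sum_swap -(size_map (fun e => (e.2, e.1))).
  by apply: word_norm_le; rewrite edge_word_swap.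
move=> xl; apply/eqP; rewrite eqn_leq le //=.
by have := le _ (edge_latticeN xl); rewrite opprK.
Qed.

Lemma word_norm_edgeMz e (k : int) : adj e.1 e.2 ->
  (word_norm (edge_vec e *~ k) <= `|k|)%N.
Proof.
move=> he; have el := edge_lattice_edge he.
have nl (n : nat) : (word_norm (edge_vec e *+ n) <= n)%N.
  have <- : word_sum (nseq n e) = edge_vec e *+ n.
    by rewrite /word_sum big_nseq iter_addr_0.
  rewrite -{2}(size_nseq n e); apply: word_norm_le.
  by rewrite /edge_word all_nseq he orbT.
case: k => n; first exact: nl.
by rewrite NegzE mulrNz word_normN ?nl //; apply: edge_latticeMz.
Qed.

End WordNorm.

(** * Words as nonnegative integer flows *)

Definition flow_sum (V : finType) (f : {ffun V * V -> nat}) : {ffun V -> int} :=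
  \sum_e edge_vec e *+ f e.

Definition flow_size (E : finType) (f : {ffun E -> nat}) : nat :=
  (\sum_e f e)%N.

Definition edge_flow (G : sgraph) (f : {ffun G * G -> nat}) : Prop :=
  forall e, ~~ adj e.1 e.2 -> f e = 0%N.

Lemma flow_sumE (V : finType) (f : {ffun V * V -> nat}) v :
  flow_sum f v = \sum_e (f e)%:R * inc e v.
Proof.
rewrite /flow_sum sum_ffunE; apply: eq_bigr => e _.
by rewrite ffunMnE ffunE mulr_natl.
Qed.

Lemma flow_sumD (V : finType) (f g : {ffun V * V -> nat}) :
  flow_sum [ffun e => (f e + g e)%N] = flow_sum f + flow_sum g.
Proof.
by rewrite /flow_sum -big_split /=; apply: eq_bigr => e _; rewrite ffunE mulrnDr.
Qed.

Lemma flow_sumMn (V : finType) (f : {ffun V * V -> nat}) k :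
  flow_sum [ffun e => (k * f e)%N] = flow_sum f *+ k.
Proof.
rewrite /flow_sum -sumrMnl; apply: eq_bigr => e _.
by rewrite ffunE mulnC mulrnA.
Qed.

Lemma flow_of_word (G : sgraph) (s : seq (G * G)) : edge_word s ->
  exists f : {ffun G * G -> nat},
    [/\ edge_flow f, flow_sum f = word_sum s & flow_size f = size s].
Proof.
elim: s => [|a s IH] /=.
  exists [ffun=> 0%N]; split=> [e _||]; rewrite ?ffunE //.
    by rewrite word_sum_nil /flow_sum big1 // => e _; rewrite ffunE.
  by rewrite /flow_size big1 // => e _; rewrite ffunE.
case/andP=> ha /IH[f [ff fs fn]].
pose d := [ffun e => (e == a : nat)] : {ffun G * G -> nat}.
exists [ffun e => (d e + f e)%N]; split.
- move=> e he; rewrite !ffunE ff // addn0; case: eqP => // ea.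
  by rewrite ea ha in he.
- rewrite flow_sumD fs word_sum_cons; congr (_ + _).
  rewrite /flow_sum (bigD1 a) //= ffunE eqxx big1 ?addr0 // => e /negPf.
  by rewrite ffunE => ->.
- rewrite /flow_size; under eq_bigr do rewrite ffunE.
  rewrite big_split /= -/(flow_size f) fn (bigD1 a) //= ffunE eqxx big1 // => e /negPf.
  by rewrite ffunE => ->.
Qed.

Lemma word_of_flow (G : sgraph) (f : {ffun G * G -> nat}) : edge_flow f ->
  exists s : seq (G * G),
    [/\ edge_word s, word_sum s = flow_sum f & size s = flow_size f].
Proof.
move=> ff; exists (flatten [seq nseq (f e) e | e <- enum {: G * G}]); split.
- apply/allP => e /flattenP[_ /mapP[e' _ ->]] /nseqP[-> fe].
  by apply: contraTT fe => /ff ->.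
- rewrite /word_sum big_flatten big_map big_enum /=; apply: eq_bigr => e _.
  by rewrite big_nseq iter_addr_0.
- rewrite size_flatten /shape -map_comp sumnE big_map big_enum /=.
  by apply: eq_bigr => e _; rewrite size_nseq.
Qed.

Lemma word_norm_flow_le (G : sgraph) (f : {ffun G * G -> nat}) : edge_flow f ->
  edge_lattice G (flow_sum f) /\ (word_norm (flow_sum f) <= flow_size f)%N.
Proof.
move=> /word_of_flow[s [sw <- <-]].
by split; [apply: edge_lattice_word|apply: word_norm_le].
Qed.

(** The rational flow [f / k.+1] has sum [x] and lies between 0 and [f]; rounding it within these
    integral bounds gives [g]. *)
Lemma flow_split (G : sgraph) (f : {ffun G * G -> nat}) x k :
  edge_flow f -> flow_sum f = x *+ k.+1 ->
  exists g : {ffun G * G -> nat},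
    [/\ edge_flow g, forall e, (g e <= f e)%N & flow_sum g = x].
Proof.
move=> ff fx; pose q (e : G * G) : rat := (f e)%:R / k.+1%:R.
have k0 : k.+1%:R != 0 :> rat by rewrite pnatr_eq0.
have kp : 0 < k.+1%:R :> rat by rewrite ltr0n.
have qx v : \sum_e q e * (inc e v)%:~R = (x v)%:~R.
  apply: (mulfI k0); rewrite mulr_sumr.
  transitivity ((flow_sum f v)%:~R : rat); last first.
    by rewrite fx ffunMnE rmorphMn /= mulr_natl.
  rewrite flow_sumE rmorph_sum /=; apply: eq_bigr => e _.
  by rewrite /q mulrA mulrCA divff // mulr1 rmorphM /= rmorph_nat.
have [|||g [gf gx _]] := @flow_rounding rat G (fun=> 0) (fun=> 0) (fun e => (f e)%:Z) q.
- move=> e; rewrite /q divr_ge0 ?ler0n //= ler_pdivrMr //.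
  by rewrite ler_peMr ?ler0n // ler1n.
- by move=> v; rewrite qx intr_int.
- move=> e; apply: contraNneq => e12.
  by rewrite /q ff ?mul0r ?rpred0 // e12 adj_irr.
have gE e : g e = `|g e|%:Z by rewrite gez0_abs //; have /andP[] := gf e.
have gle e : (`|g e| <= f e)%N by rewrite -lez_nat -gE; have /andP[] := gf e.
exists [ffun e => `|g e|%N]; split=> [e he|e|]; rewrite ?ffunE //.
  by apply/eqP; rewrite -leqn0 -(ff e he).
apply/ffunP => v; apply: (@intr_inj rat); rewrite -qx gx flow_sumE.
congr (_%:~R); apply: eq_bigr => e _; by rewrite ffunE natz -gE.
Qed.

(** An optimal flow for [x + x] splits by [flow_split] into two integer flows, each with sum [x].
    This is the source of the convexity of the norm along lines. *)
Lemma word_norm_double (G : sgraph) (x : {ffun G -> int}) : edge_lattice G x ->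
  ((word_norm x).*2 <= word_norm (x + x))%N.
Proof.
move=> xl; have [s [sw sx <-]] := word_normP (edge_latticeD xl xl).
have [f [ff fx <-]] := flow_of_word sw.
have [|g [gf gle gx]] := @flow_split G f x 1 ff; first by rewrite fx sx.
pose h := [ffun e => (f e - g e)%N].
have hf : edge_flow h by move=> e he; rewrite ffunE ff.
have fgh : f = [ffun e => (g e + h e)%N].
  by apply/ffunP => e; rewrite !ffunE subnKC.
have hx : flow_sum h = x.
  apply: (addrI x); rewrite -{1}gx -flow_sumD -fgh fx; exact: sx.
have fs : flow_size f = (flow_size g + flow_size h)%N.
  by rewrite {1}fgh /flow_size -big_split; apply: eq_bigr => e _; rewrite ffunE.
rewrite fs -addnn leq_add //.
  by rewrite -{1}gx; apply: (word_norm_flow_le gf).2.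
by rewrite -{1}hx; apply: (word_norm_flow_le hf).2.
Qed.

(** * Reduced vectors and gluing *)

Section Bipartite.
Variables (G : sgraph) (bipG : sgraph_bipartite G).
Implicit Types (x y : {ffun G -> int}) (s : seq (G * G)) (e : G * G).

(** The sum [chi] over one colour class is odd on every edge vector, so [word_norm x] has the parity
    of [chi x]. The two norms therefore have different parities, while they differ by at most 1. *)
Lemma word_norm_neighbour x e : edge_lattice G x -> adj e.1 e.2 ->
  word_norm (x + edge_vec e) = (word_norm x).+1
  \/ word_norm x = (word_norm (x + edge_vec e)).+1.
Proof.
move=> xl he; have el := edge_lattice_edge he.
have [c cP] := bipG.
pose chi x := \sum_(v | c v) x v.
have chiD x1 x2 : chi (x1 + x2) = chi x1 + chi x2.
  by rewrite /chi -big_split; apply: eq_bigr => v _; rewrite ffunE.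
have chi_e e1 : adj e1.1 e1.2 ->
    exists2 m : int, chi (edge_vec e1) = 1 + 2 * m & m = 0 \/ m = -1.
  move=> /cP; rewrite /chi; under eq_bigr do rewrite ffunE /inc.
  have h a : \sum_(v | c v) (v == a)%:R = (c a)%:R :> int.
    rewrite big_mkcond (bigD1 a) //= eqxx big1 ?addr0; last first.
      by move=> v /negPf ->; case: ifP.
    by case: (c a).
  rewrite sumrB !h; case: (c e1.1); case: (c e1.2) => // _.
    by exists 0; [|left].
  by exists (-1); [|right].
have chi_s s : edge_word s -> exists m : int, chi (word_sum s) = (size s)%:Z + 2 * m.
  elim: s => [|e1 s IH] /=.
    by exists 0; rewrite word_sum_nil /chi big1 // => v _; rewrite ffunE.
  case/andP=> /chi_e[m hm _] /IH[m' hm'].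
  by exists (m + m'); rewrite word_sum_cons chiD; lia.
have [s [sw sx sn]] := word_normP xl.
have [t [tw tx tn]] := word_normP (edge_latticeD xl el).
have [m hm] := chi_s _ sw; have [m' hm'] := chi_s _ tw.
have [m2 hm2 _] := chi_e _ he.
rewrite sx sn in hm; rewrite tx tn chiD in hm'.
have e1 : (word_norm (edge_vec e) <= 1)%N := word_norm_edgeMz 1 he.
have up := word_normD xl el.
have dn := word_normD (edge_latticeD xl el) (edge_latticeN el).
rewrite addrK word_normN // in dn.
lia.
Qed.

End Bipartite.

Section Reduced.
Variables (G : sgraph) (e : G * G).
Hypothesis he : adj e.1 e.2.
Implicit Types (x y : {ffun G -> int}).
Let el : edge_lattice G (edge_vec e) := edge_lattice_edge he.

(** A strict local minimum of the norm on the line through [y] in the direction of the edge vector;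
    convexity makes it the unique global one. *)
Definition edge_reduced (y : {ffun G -> int}) : Prop :=
  [/\ edge_lattice G y, word_norm (y + edge_vec e) = (word_norm y).+1
    & word_norm (y - edge_vec e) = (word_norm y).+1].

(* Convexity of [n |-> word_norm (y + b *+ n)], a consequence of
   [word_norm_double], propagates the slope 1. *)
Lemma word_norm_ray y b n : edge_lattice G y -> edge_lattice G b ->
  (word_norm b <= 1)%N -> word_norm (y + b) = (word_norm y).+1 ->
  word_norm (y + b *+ n) = (word_norm y + n)%N.
Proof.
move=> yl bl b1 yb.
have ln m : edge_lattice G (y + b *+ m).
  by apply: edge_latticeD => //; rewrite pmulrn; apply: edge_latticeMz.
suff: word_norm (y + b *+ n) = (word_norm y + n)%N /\
      word_norm (y + b *+ n.+1) = (word_norm y + n.+1)%N by case.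
elim: n => [|n [IH1 IH2]]; first by rewrite mulr0n addr0 addn0 mulr1n yb addn1.
split=> //.
(* Midpoint convexity at [n.+1] bounds the value at [n.+2] from below; the triangle inequality
   bounds it from above. *)
have dbl := word_norm_double (ln n.+1).
have tri := word_normD (ln n.+2) (ln n).
have stp := word_normD (ln n.+1) bl.
rewrite -addrA -mulrSr in stp.
have E : (y + b *+ n.+1) + (y + b *+ n.+1) = (y + b *+ n.+2) + (y + b *+ n).
  by rewrite addrACA [RHS]addrACA -!mulrnDr; congr (_ + _ *+ _); lia.
rewrite E in dbl; have {dbl tri} := leq_trans dbl tri; rewrite IH1 IH2 => dbl.
by apply/eqP; rewrite eqn_leq (leq_trans stp) ?IH2 /=; lia.
Qed.

Lemma edge_reduced_norm y (k : int) : edge_reduced y ->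
  word_norm (y + edge_vec e *~ k) = (word_norm y + `|k|)%N.
Proof.
have e1 : (word_norm (edge_vec e) <= 1)%N := word_norm_edgeMz 1 he.
case=> yl yp ym; case: k => n; first exact: word_norm_ray.
(* [Negz n] is [- n.+1]: the same ray argument is run in the opposite direction. *)
rewrite NegzE mulrNz -mulNrz abszN absz_nat; apply: word_norm_ray => //.
  exact: edge_latticeN.
by rewrite word_normN.
Qed.

(** Applying [edge_reduced_norm] from either vector to the other gives [|k| + |k| = 0]. *)
Lemma edge_reduced_uniq y (k : int) :
  edge_reduced y -> edge_reduced (y + edge_vec e *~ k) -> k = 0.
Proof.
move=> ry rk; have h1 := edge_reduced_norm k ry.
have := edge_reduced_norm (- k) rk; rewrite mulrNz addrK; lia.
Qed.

(** A minimiser of the norm on the coset is reduced: its two neighbours have a different norm by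
    bipartiteness, and not a smaller one. *)
Lemma edge_reduced_exists x : sgraph_bipartite G -> edge_lattice G x ->
  exists k : int, edge_reduced (x + edge_vec e *~ k).
Proof.
move=> bipG xl.
have ll k : edge_lattice G (x + edge_vec e *~ k).
  by apply: edge_latticeD => //; apply: edge_latticeMz.
pose P n := `[< exists k : int, word_norm (x + edge_vec e *~ k) = n >].
have exP : exists n, P n.
  by exists (word_norm (x + edge_vec e *~ 0)); apply/asboolP; exists 0.
case: (ex_minnP exP) => n /asboolP[k kn] nmin.
have ge k' : (word_norm (x + edge_vec e *~ k) <= word_norm (x + edge_vec e *~ k'))%N.
  by rewrite kn; apply: nmin; apply/asboolP; exists k'.
exists k; split=> //.
  have [//|] := word_norm_neighbour bipG (ll k) he.
  by move=> E; have := ge (k + 1); rewrite mulrzDr mulr1z addrA E ltnn.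
have he' : adj (e.2, e.1).1 (e.2, e.1).2 by rewrite adj_sym.
have := word_norm_neighbour bipG (ll k) he'; rewrite edge_vec_swap => -[//|].
by move=> E; have := ge (k - 1); rewrite mulrzBr mulr1z addrA E ltnn.
Qed.

End Reduced.

(** * Pushing integer vectors forward along a vertex map *)

Definition pushforward (U V : finType) (h : U -> V) (x : {ffun U -> int}) :
  {ffun V -> int} := [ffun a => \sum_(u | h u == a) x u].

Section Pushforward.
Variables (U V : finType) (h : U -> V).

Fact pushforward_is_zmod_morphism : zmod_morphism (pushforward h).
Proof.
move=> x y; apply/ffunP => a; rewrite !ffunE -sumrB.
by apply: eq_bigr => u _; rewrite !ffunE.
Qed.
HB.instance Definition _ :=
  GRing.isZmodMorphism.Build {ffun U -> int} {ffun V -> int} (pushforward h)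
    pushforward_is_zmod_morphism.

Lemma pushforward_edge e : pushforward h (edge_vec e) = edge_vec (h e.1, h e.2).
Proof.
apply/ffunP => a; rewrite !ffunE /inc; under eq_bigr do rewrite ffunE.
have sum1 c : \sum_(u | h u == a) (u == c)%:R = (a == h c)%:R :> int.
  rewrite big_mkcond (bigD1 c) //= eqxx big1 ?addr0; last first.
    by move=> v /negPf ->; case: ifP.
  by rewrite eq_sym; case: eqP.
by rewrite sumrB !sum1.
Qed.

Lemma pushforward_word s :
  pushforward h (word_sum s) = word_sum [seq (h e.1, h e.2) | e <- s].
Proof.
rewrite /word_sum raddf_sum big_map; apply: eq_bigr => e _.
exact: pushforward_edge.
Qed.

Lemma pushforwardE x u : injective h -> pushforward h x (h u) = x u.
Proof.
move=> hi; rewrite ffunE (eq_bigl (pred1 u)) ?big_pred1_eq // => w.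
exact: inj_eq.
Qed.

Lemma pushforward_inj : injective h -> injective (pushforward h).
Proof.
by move=> hi x y xy; apply/ffunP => u; rewrite -!(pushforwardE _ _ hi) xy.
Qed.

End Pushforward.

Lemma ffunMzE (V : finType) (x : {ffun V -> int}) (k : int) v :
  (x *~ k) v = x v * k.
Proof.
case: k => n; first by rewrite -pmulrn ffunMnE -mulr_natr natz.
by rewrite NegzE mulrNz ffunE -pmulrn ffunMnE mulrN -mulr_natr natz.
Qed.

(** * Lattice and norm of a glued graph *)

Section Gluing.
Variables (G1 G2 G : sgraph) (v1 w1 : G1) (v2 w2 : G2) (pi : G1 + G2 -> G).
Hypotheses (bip2 : sgraph_bipartite G2).
Hypotheses (adj1 : adj v1 w1) (adj2 : adj v2 w2).
Hypothesis glue : edge_gluing v1 w1 v2 w2 pi.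

Let i1 : {ffun G1 -> int} -> {ffun G -> int} := pushforward (fun u => pi (inl u)).
Let i2 : {ffun G2 -> int} -> {ffun G -> int} := pushforward (fun u => pi (inr u)).
Let b1 := edge_vec (v1, w1).
Let b2 := edge_vec (v2, w2).

Lemma pi_inl_inj : injective (fun u => pi (inl u)).
Proof. by move=> u v /(proj1 (let: And3 _ h _ := glue in h _ _)) /= /eqP. Qed.

Lemma pi_inr_inj : injective (fun u => pi (inr u)).
Proof. by move=> u v /(proj1 (let: And3 _ h _ := glue in h _ _)) /= /eqP. Qed.

Lemma gluing_edge : i1 b1 = i2 b2.
Proof.
have [_ piE _] := glue.
rewrite /i1 /i2 /b1 /b2 !pushforward_edge /=; congr (edge_vec (_, _)).
  by apply/(piE _ _) => /=; rewrite !eqxx.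
by apply/(piE _ _) => /=; rewrite !eqxx orbT.
Qed.

Lemma gluing_edgeMz (k : int) : i1 (b1 *~ k) = i2 (b2 *~ k).
Proof. by rewrite /i1 /i2 !raddfMz; congr (_ *~ _); apply: gluing_edge. Qed.

Lemma gluing_adj_inl u v : adj u v -> adj (pi (inl u)) (pi (inl v)).
Proof. by have [_ _ adjE] := glue => h; apply/adjE; exists (inl u), (inl v). Qed.

Lemma gluing_adj_inr u v : adj u v -> adj (pi (inr u)) (pi (inr v)).
Proof. by have [_ _ adjE] := glue => h; apply/adjE; exists (inr u), (inr v). Qed.

Lemma gluing_word (s1 : seq (G1 * G1)) (s2 : seq (G2 * G2)) :
  edge_word s1 -> edge_word s2 ->
  exists s : seq (G * G),
    [/\ edge_word s, word_sum s = i1 (word_sum s1) + i2 (word_sum s2)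
      & size s = (size s1 + size s2)%N].
Proof.
move=> s1w s2w.
exists ([seq (pi (inl e.1), pi (inl e.2)) | e <- s1] ++
        [seq (pi (inr e.1), pi (inr e.2)) | e <- s2]); split.
- rewrite /edge_word all_cat !all_map; apply/andP; split.
    by apply: sub_all s1w => e; apply: gluing_adj_inl.
  by apply: sub_all s2w => e; apply: gluing_adj_inr.
- by rewrite word_sum_cat /i1 /i2 !pushforward_word.
- by rewrite size_cat !size_map.
Qed.

(** Every edge of [G] lifts to an edge of [G1] or of [G2]; sorting the letters accordingly preserves
    the total length. *)
Lemma gluing_word_split (s : seq (G * G)) : edge_word s ->
  exists (s1 : seq (G1 * G1)) (s2 : seq (G2 * G2)),
    [/\ edge_word s1, edge_word s2,
        word_sum s = i1 (word_sum s1) + i2 (word_sum s2)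
      & size s = (size s1 + size s2)%N].
Proof.
have [_ _ adjE] := glue.
elim: s => [|[a b] s IH] /=.
  by exists [::], [::]; split=> //; rewrite !word_sum_nil /i1 /i2 !raddf0 addr0.
case/andP=> /adjE[x [y [<- <- xy]]] /IH[s1 [s2 [s1w s2w ss sn]]].
case: x y xy => [x|x] [y|y] //= xy.
  exists ((x, y) :: s1), s2; split; rewrite ?sn //.
    by rewrite /edge_word /= xy.
  by rewrite !word_sum_cons ss /i1 raddfD /= pushforward_edge addrA.
exists s1, ((x, y) :: s2); split; rewrite ?sn //.
- by rewrite /edge_word /= xy.
- by rewrite !word_sum_cons ss /i2 raddfD /= pushforward_edge addrCA.
- by rewrite addnS.
Qed.

(** Off the glued edge a vertex of [G2] receives nothing from [G1], so [y] lives on [v2] and [w2].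
    Its entries sum to zero, so it is a multiple of [b2], and [x] follows by injectivity of [i1]. *)
Lemma gluing_kernel x y : edge_lattice G2 y -> i1 x + i2 y = 0 ->
  exists k : int, y = b2 *~ k /\ x = - (b1 *~ k).
Proof.
move=> yl xy; have [_ piE _] := glue.
have nvw : v2 != w2 by apply: contraTneq adj2 => ->; rewrite adj_irr.
have yout u : u != v2 -> u != w2 -> y u = 0.
  move=> uv uw; have /ffunP/(_ (pi (inr u))) := xy.
  rewrite !ffunE [X in X + _]big1; last first.
    by move=> a /eqP/piE /=; rewrite (negPf uv) (negPf uw) !andbF.
  rewrite add0r (eq_bigl (pred1 u)) ?big_pred1_eq // => a.
  exact: (inj_eq pi_inr_inj).
have yE : y = b2 *~ y v2.
  have s0 := edge_lattice_sum0 yl.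
  rewrite (bigD1 v2) // (bigD1 w2) 1?eq_sym //= big1 ?addr0 in s0; last first.
    by move=> u /andP[]; apply: yout.
  apply/ffunP => u; rewrite ffunMzE ffunE /inc /=.
  have [->|uv] := eqVneq u v2; first by rewrite (negPf nvw) subr0 mul1r.
  have [->|uw] := eqVneq u w2; last by rewrite subrr mul0r yout.
  by rewrite sub0r mulN1r; apply/eqP; rewrite -addr_eq0 addrC s0.
exists (y v2); split=> //.
apply: (pushforward_inj pi_inl_inj); rewrite raddfN /=.
apply/eqP; rewrite -addr_eq0 -xy; apply/eqP; congr (_ + _).
by rewrite {2}yE; apply: gluing_edgeMz.
Qed.

Let redu := edge_reduced (v2, w2).

(** Concatenating optimal words gives the upper bound. For the lower bound, an optimal word of [G]
    splits into parts that differ from [x] and [y] by opposite multiples of the glued edge vector.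
    As [y] is reduced, the shift by [k] costs exactly [|k|] in [G2], and it saves at most [|k|] in
    [G1]. *)
Lemma gluing_norm x y : edge_lattice G1 x -> redu y ->
  edge_lattice G (i1 x + i2 y) /\
  word_norm (i1 x + i2 y) = (word_norm x + word_norm y)%N.
Proof.
move=> xl ry; have [yl _ _] := ry.
have [s1 [s1w s1x s1n]] := word_normP xl.
have [s2 [s2w s2y s2n]] := word_normP yl.
have [s [sw ss sn]] := gluing_word s1w s2w.
rewrite s1x s2y in ss.
have zl : edge_lattice G (i1 x + i2 y) by rewrite -ss; apply: edge_lattice_word.
split=> //; apply/eqP; rewrite eqn_leq; apply/andP; split.
  by rewrite -ss -s1n -s2n -sn; apply: word_norm_le.
have [t [tw tz <-]] := word_normP zl.
have [t1 [t2 [t1w t2w tt ->]]] := gluing_word_split tw.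
have t1l := edge_lattice_word t1w; have t2l := edge_lattice_word t2w.
have [||k [k2 k1]] := @gluing_kernel (word_sum t1 - x) (word_sum t2 - y).
- by apply: edge_latticeD => //; apply: edge_latticeN.
- by rewrite /i1 /i2 !raddfB /= addrACA -opprD -tt tz subrr.
have yk : word_sum t2 = y + b2 *~ k by rewrite -k2 addrC subrK.
have xk : x = word_sum t1 + b1 *~ k by rewrite -[b1 *~ k]opprK -k1 opprB addrC subrK.
have h2 : word_norm (word_sum t2) = (word_norm y + `|k|)%N.
  by rewrite yk; apply: edge_reduced_norm.
have n1 := word_norm_le t1w; have n2 := word_norm_le t2w.
have bk : (word_norm (b1 *~ k) <= `|k|)%N by apply: word_norm_edgeMz.
have b1l : edge_lattice G1 b1 by apply: edge_lattice_edge.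
have := word_normD t1l (edge_latticeMz k b1l).
rewrite -xk; lia.
Qed.

(** Two decompositions differ by a multiple of the glued edge vector, which [edge_reduced_uniq]
    forces to be zero. *)
Lemma gluing_inj x y x' y' : redu y -> redu y' ->
  i1 x + i2 y = i1 x' + i2 y' -> x = x' /\ y = y'.
Proof.
move=> ry ry' E; have [yl _ _] := ry; have [yl' _ _] := ry'.
have [||k [k2 k1]] := @gluing_kernel (x' - x) (y' - y).
- by apply: edge_latticeD => //; apply: edge_latticeN.
- by rewrite /i1 /i2 !raddfB /= addrACA -opprD -E subrr.
have yk : y' = y + b2 *~ k by rewrite -k2 addrC subrK.
have k0 : k = 0 by apply: (@edge_reduced_uniq G2 (v2, w2) adj2 y) => //; rewrite -yk.
move: k1 k2; rewrite k0 !mulr0z oppr0.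
by move=> /eqP; rewrite subr_eq0 => /eqP -> /eqP; rewrite subr_eq0 => /eqP ->.
Qed.

(** A multiple of the glued edge vector is moved from the [G1] part to the [G2] part to make the
    latter reduced; bipartiteness provides that multiple. *)
Lemma gluing_surj z : edge_lattice G z ->
  exists x y, [/\ edge_lattice G1 x, redu y & z = i1 x + i2 y].
Proof.
case=> s sw <-; have [s1 [s2 [s1w s2w -> _]]] := gluing_word_split sw.
have [k rk] := edge_reduced_exists (adj2 : adj (v2, w2).1 (v2, w2).2) bip2
                 (edge_lattice_word s2w).
exists (word_sum s1 - b1 *~ k), (word_sum s2 + b2 *~ k); split=> //.
  apply: edge_latticeD; first exact: edge_lattice_word.
  by apply/edge_latticeN/edge_latticeMz/edge_lattice_edge.
have -> : i1 (word_sum s1 - b1 *~ k) = i1 (word_sum s1) - i2 (b2 *~ k).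
  by rewrite -gluing_edgeMz; apply: raddfB.
have -> : i2 (word_sum s2 + b2 *~ k) = i2 (word_sum s2) + i2 (b2 *~ k).
  exact: raddfD.
by rewrite addrACA addNr addr0.
Qed.

Lemma gluing_card : #|G| = (#|G1| + #|G2| - 2)%N.
Proof.
have [surj piE _] := glue.
have nvw : v2 != w2 by apply: contraTneq adj2 => ->; rewrite adj_irr.
(* Without [inr v2] and [inr w2] exactly one representative of each class remains. *)
pose T : {set G1 + G2} := (~: [set inr v2; inr w2])%SET.
have inrE (a b : G2) : (@inr G1 G2 a == inr b) = (a == b) by [].
have injT : {in T &, injective pi}.
  move=> a b; rewrite !inE !negb_or => /andP[a1 a2] /andP[c1 c2] /piE.
  case: a a1 a2 => a; case: b c1 c2 => b //= c1 c2 a1 a2.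
  - by move/eqP->.
  - by move: c1 c2; rewrite !inrE => /negPf -> /negPf ->; rewrite !andbF.
  - by move: a1 a2; rewrite !inrE => /negPf -> /negPf ->; rewrite !andbF.
  - by move/eqP->.
have imT : (pi @: T = [set: G])%SET.
  apply/setP => a; rewrite inE; apply/imsetP; have [x xa] := surj a.
  have [xT|xT] := boolP (x \in T); first by exists x.
  move: xT; rewrite !inE negbK => /orP[]/eqP xE.
    exists (inl v1); rewrite ?inE //= -xa xE; apply/piE => /=.
    by rewrite !eqxx.
  exists (inl w1); rewrite ?inE //= -xa xE; apply/piE => /=.
  by rewrite !eqxx orbT.
rewrite -cardsT -imT card_in_imset // cardsCs finset.setCK cards2.
by rewrite card_sum nvw.
Qed.

End Gluing.

(** * Truncated generating functions *)

Local Open Scope classical_set_scope.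
Local Open Scope ring_scope.

(** * Congruence of polynomials modulo powers of the variable *)

Section EqModX.
Variable R : fieldType.
Implicit Types p q r : {poly R}.

(** Power series are represented by their truncations: an identity of series becomes a congruence
    for every [N]. *)
Definition eqmodX (N : nat) p q : bool := 'X^N %| p - q.

Lemma eqmodX_refl N p : eqmodX N p p.
Proof. by rewrite /eqmodX subrr dvdp0. Qed.

Lemma eqmodX_sym N p q : eqmodX N p q -> eqmodX N q p.
Proof. by rewrite /eqmodX -opprB dvdpNr. Qed.

Lemma eqmodX_trans N p q r : eqmodX N p q -> eqmodX N q r -> eqmodX N p r.
Proof. by move=> pq qr; rewrite /eqmodX -(subrKA q) dvdp_add. Qed.

Lemma eqmodXD N p q p' q' :
  eqmodX N p q -> eqmodX N p' q' -> eqmodX N (p + p') (q + q').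
Proof. by move=> pq pq'; rewrite /eqmodX opprD addrACA dvdp_add. Qed.

Lemma eqmodXM N p q p' q' :
  eqmodX N p q -> eqmodX N p' q' -> eqmodX N (p * p') (q * q').
Proof.
move=> pq pq'; rewrite /eqmodX.
have -> : p * p' - q * q' = (p - q) * p' + q * (p' - q') by ring.
by apply: dvdp_add; [apply: dvdp_mulr|apply: dvdp_mull].
Qed.

Lemma eqmodX_coef N p q :
  reflect (forall i, (i < N)%N -> p`_i = q`_i) (eqmodX N p q).
Proof.
apply: (iffP idP) => [/dvdpP[r pq] i iN|pq].
  by apply/eqP; rewrite -subr_eq0 -coefB pq coefMXn iN.
rewrite /eqmodX -[p - q](poly_take_drop N) dvdp_add //; last by rewrite dvdp_mull.
suff -> : take_poly N (p - q) = 0 by rewrite dvdp0.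
apply/polyP => i; rewrite coef_take_poly coef0; case: ifP => // iN.
by rewrite coefB pq // subrr.
Qed.

Lemma eqmodX_eq p q : (forall N, eqmodX N p q) -> p = q.
Proof. by move=> pq; apply/polyP => i; apply: (eqmodX_coef _ _ _ (pq i.+1)). Qed.

Lemma eqmodX_sum (I : Type) (s : seq I) (P : pred I) N (F F' : I -> {poly R}) :
  (forall i, P i -> eqmodX N (F i) (F' i)) ->
  eqmodX N (\sum_(i <- s | P i) F i) (\sum_(i <- s | P i) F' i).
Proof.
by move=> FF'; apply: (big_ind2 (eqmodX N)) => // [|*]; [apply: eqmodX_refl|apply: eqmodXD].
Qed.

Lemma eqmodX_prod (I : Type) (s : seq I) (P : pred I) N (F F' : I -> {poly R}) :
  (forall i, P i -> eqmodX N (F i) (F' i)) ->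
  eqmodX N (\prod_(i <- s | P i) F i) (\prod_(i <- s | P i) F' i).
Proof.
by move=> FF'; apply: (big_ind2 (eqmodX N)) => // [|*]; [apply: eqmodX_refl|apply: eqmodXM].
Qed.

Lemma geometric_sum n : (1 - 'X) * \sum_(i < n) 'X^i = 1 - 'X^n :> {poly R}.
Proof. by rewrite -[RHS]opprB subrX1 -mulNr opprB. Qed.

End EqModX.

(** * Generating functions of weighted sets *)

Section GeneratingFunction.
Variable R : fieldType.
Implicit Types T U : choiceType.

(** Without this finiteness the sum in [gf] would run over an infinite support and take its default
    value 0. *)
Definition graded_finite T (A : set T) (w : T -> nat) : Prop :=
  forall N, finite_set (A `&` [set x | (w x < N)%N]).

Definition gf T (A : set T) (w : T -> nat) (N : nat) : {poly R} :=
  \sum_(x \in A `&` [set x | (w x < N)%N]) ('X^(w x) : {poly R}).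

Lemma gf_bij T U (A : set T) (B : set U) wA wB (h : T -> U) N :
  set_bij A B h -> (forall x, A x -> wB (h x) = wA x) -> gf B wB N = gf A wA N.
Proof.
case=> hf hi hs hw; rewrite /gf (reindex_fsbig h (A `&` [set x | (wA x < N)%N])).
  by apply: eq_fsbigr => x; rewrite inE => -[Ax _]; rewrite hw.
split.
- by move=> x [Ax wx]; split; [apply: hf|rewrite /= hw].
- by move=> x y; rewrite !inE => -[Ax _] [Ay _]; apply: hi; rewrite inE.
- move=> y [By wy]; have [x Ax xy] := hs _ By.
  by exists x => //; split=> //=; rewrite -hw // xy.
Qed.

Lemma graded_finite_bij T U (A : set T) (B : set U) wA wB (h : T -> U) :
  set_bij A B h -> (forall x, A x -> wB (h x) = wA x) ->
  graded_finite A wA -> graded_finite B wB.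
Proof.
move=> [hf hi hs] hw fA N; apply: sub_finite_set (finite_image h (fA N)).
move=> y [By wy]; have [x Ax xy] := hs _ By.
by exists x => //; split=> //=; rewrite -hw // xy.
Qed.

(** Terms of weight at least [N] are divisible by ['X^N], so any convenient finite set, such as a
    box, may replace the exact truncation. *)
Lemma gf_superset T (A B : set T) w N : finite_set B -> B `<=` A ->
  A `&` [set x | (w x < N)%N] `<=` B ->
  eqmodX N (\sum_(x \in B) ('X^(w x) : {poly R})) (gf A w N).
Proof.
move=> fB BA AB; rewrite (fsbigID [set x | (w x < N)%N]) //= /gf.
have -> : A `&` [set x | (w x < N)%N] = B `&` [set x | (w x < N)%N].
  apply/seteqP; split=> x [xA xN]; split=> //; last exact: BA.
  by apply: AB.
have fC : finite_set (B `&` ~` [set x | (w x < N)%N]) by apply: finite_setIl.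
rewrite /eqmodX addrAC subrr add0r fsbig_finite // big_seq.
apply: (big_ind (fun p : {poly R} => 'X^N %| p)); [exact: dvdp0|exact: dvdp_add|].
move=> x; rewrite in_fset_set // inE => -[_ /= /negP]; rewrite -leqNgt => wN.
by apply: dvdp_exp2l.
Qed.

(** The product of the two truncated sets contains every pair of total weight below [N], so
    [gf_superset] applies. *)
Lemma gf_prod T U (A : set T) (B : set U) wA wB N :
  graded_finite A wA -> graded_finite B wB ->
  eqmodX N (gf A wA N * gf B wB N)
    (gf (A `*` B) (fun p => wA p.1 + wB p.2)%N N).
Proof.
move=> fA fB; rewrite /gf mulr_fsuml.
under eq_fsbigr => x _ do rewrite mulr_fsumr.
rewrite (pair_fsbig _ (fun x y => 'X^(wA x) * 'X^(wB y))) //.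
under eq_fsbigr do rewrite -exprD.
apply: (@gf_superset (T * U)%type) => /=.
- exact: finite_setX.
- by move=> [x y] [[Ax _] [By _]].
- move=> [x y] [[/= Ax By] wN]; split; split=> //=.
    exact: leq_ltn_trans (leq_addr _ _) wN.
  exact: leq_ltn_trans (leq_addl _ _) wN.
Qed.

(** The series of [t^|k|] over the integers is [(1 + t) / (1 - t)]. *)
Lemma gf_int N :
  eqmodX N ((1 - 'X) * gf [set: int] (fun k => `|k|%N) N) (1 + 'X).
Proof.
case: N => [|N]; first by rewrite /eqmodX expr0 dvd1p.
(* [Negz i] has absolute value [i + 1], hence one negative number fewer than nonnegative ones. *)
pose r := [seq Posz i | i <- iota 0 N.+1] ++ [seq Negz i | i <- iota 0 N].
have rP n : (Posz n \in r) = (n < N.+1)%N.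
  rewrite mem_cat mem_map; last by move=> ? ? [].
  by rewrite mem_iota add0n /= orbC; case: mapP => [[? _ []]|_].
have rN n : (Negz n \in r) = (n < N)%N.
  rewrite mem_cat orbC mem_map; last by move=> ? ? [].
  by rewrite mem_iota add0n; case: mapP => [[? _ //]|_]; rewrite orbF.
have rE : [set: int] `&` [set k | (`|k| < N.+1)%N] = [set` r].
  by rewrite setTI; apply/seteqP; split=> -[n|n] /=; rewrite ?rP ?rN.
have ur : uniq r.
  rewrite cat_uniq !map_inj_uniq ?iota_uniq; try by move=> ? ? [].
  by rewrite andbT /=; apply/hasPn => _ /mapP[n _ ->]; apply/mapP => -[].
have iotaE n (F : nat -> {poly R}) : \sum_(i <- iota 0 n) F i = \sum_(i < n) F i.
  by rewrite -{1}[n]subn0 -/(index_iota 0 n) big_mkord.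
rewrite /gf rE -fsbig_seq // big_cat !big_map !iotaE.
have -> : \sum_(i < N) 'X^`|Negz i|%N = 'X * \sum_(i < N) 'X^i :> {poly R}.
  by rewrite mulr_sumr; apply: eq_bigr => i _; rewrite -exprS.
rewrite mulrDr mulrCA (geometric_sum R N.+1) geometric_sum /eqmodX.
have -> : (1 - 'X^(N.+1)) + 'X * (1 - 'X^N) - (1 + 'X) = - 2%:R * 'X^(N.+1) :> {poly R}.
  by rewrite exprS; ring.
exact: dvdp_mull.
Qed.

(** An element of weight [w] is counted for every [j] from [w] on, contributing [t^w / (1 - t)].
    This converts the counts of an Ehrhart series into counts by exact norm. *)
Lemma gf_cumulative T (A : set T) w N : graded_finite A w ->
  eqmodX N
    ((1 - 'X) *
      \poly_(j < N) (#|` fset_set (A `&` [set x | (w x <= j)%N])|%:R : R))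
    (gf A w N).
Proof.
move=> fA; set F := fset_set (A `&` [set x | (w x < N)%N]).
have cE (j : 'I_N) : #|` fset_set (A `&` [set x | (w x <= j)%N])|%:R =
    \sum_(x <- F) (w x <= j)%:R :> R.
  rewrite card_fset_sum1 natr_sum -fsbig_finite; last exact: (fA j.+1).
  have -> : A `&` [set x | (w x <= j)%N] =
     (A `&` [set x | (w x < N)%N]) `&` [set x | (w x <= j)%N].
    apply/seteqP; split=> x [] //; last by move=> [].
    by move=> Ax wx; split=> //; split=> //=; apply: leq_ltn_trans wx _.
  rewrite fsbig_mkcondr fsbig_finite //; apply: eq_bigr => x _.
  by case: ifPn; [rewrite inE /= => ->|rewrite notin_setE /= => /negP/negPf ->].
rewrite poly_def /gf fsbig_finite // -/F.
have -> : \sum_(j < N) (#|` fset_set (A `&` [set x | (w x <= j)%N])|%:R : R) *: 'X^j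
   = \sum_(x <- F) \sum_(j < N) (w x <= j)%:R *: 'X^j :> {poly R}.
  by rewrite exchange_big; apply: eq_bigr => j _; rewrite cE scaler_suml.
rewrite mulr_sumr big_seq [X in eqmodX _ _ X]big_seq; apply: eqmodX_sum => x.
rewrite in_fset_set // inE => -[_ /= wN].
have -> : (1 - 'X) * \sum_(j < N) (w x <= j)%:R *: 'X^j = 'X^(w x) - 'X^N :> {poly R}.
  transitivity ((1 - 'X) * (\sum_(j < N) 'X^j - \sum_(j < w x) 'X^j) : {poly R}).
    congr (_ * _); rewrite (big_ord_widen N (fun j => 'X^j : {poly R}) (ltnW wN)).
    rewrite [X in _ - X]big_mkcond -sumrB.
    apply: eq_bigr => j _; rewrite ltnNge; case: leqP => _ /=.
      by rewrite scale1r subr0.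
    by rewrite scale0r subrr.
  by rewrite mulrBr !geometric_sum opprB addrC subrKA.
by rewrite /eqmodX addrAC subrr add0r dvdpNr.
Qed.

End GeneratingFunction.

(** * Canonical flows *)

Definition flow_support (E : finType) (f : {ffun E -> nat}) : {set E} :=
  [set e | (0 < f e)%N]%SET.

Lemma flow_size_ge (E : finType) (f : {ffun E -> nat}) e : (f e <= flow_size f)%N.
Proof. by rewrite /flow_size (bigD1 e) //= leq_addr. Qed.

Lemma graded_finite_flows (E : finType) (C : set {ffun E -> nat}) :
  graded_finite C (@flow_size E).
Proof.
move=> N; pose F (a : {ffun E -> 'I_N}) : {ffun E -> nat} := [ffun e => val (a e)].
apply: (@sub_finite_set _ _ (range F)); last exact/finite_image/finite_finset.
move=> f [_ /= fN]; have fe e : (f e < N)%N := leq_ltn_trans (flow_size_ge f e) fN.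
by exists [ffun e => Ordinal (fe e)] => //; apply/ffunP => e; rewrite !ffunE.
Qed.

(** Flows with support exactly [S] have generating function [(t / (1 - t))^|S|]: each edge of [S]
    independently takes a positive value. The factor [(1 - 'X) ^+ #|E|] clears all denominators. *)
Lemma gf_support_closed (R : fieldType) (E : finType) (Delta : pred {set E}) N :
  eqmodX N
    ((1 - 'X) ^+ #|E| *
       gf R [set f : {ffun E -> nat} | Delta (flow_support f)] (@flow_size E) N)
    (\sum_(S | Delta S) \prod_e (if e \in S then 'X else 1 - 'X)).
Proof.
case: N => [|N]; first by rewrite /eqmodX expr0 dvd1p.
set C := [set f | _].
pose F (a : {ffun E -> 'I_N.+1}) : {ffun E -> nat} := [ffun e => val (a e)].
pose B := F @` [set a | Delta (flow_support (F a))].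
have Finj : injective F.
  by move=> a b /ffunP ab; apply/ffunP => e; apply: val_inj; have := ab e; rewrite !ffunE.
have fB : finite_set B by apply/finite_image/finite_finset.
have BC : B `<=` C by move=> _ [a aD <-].
have CB : C `&` [set f | (flow_size f < N.+1)%N] `<=` B.
  move=> f [fC fN]; have fe e : (f e < N.+1)%N := leq_ltn_trans (flow_size_ge f e) fN.
  have Ff : F [ffun e => Ordinal (fe e)] = f by apply/ffunP => e; rewrite !ffunE.
  by exists [ffun e => Ordinal (fe e)]; rewrite /= ?Ff.
have /eqmodX_sym := gf_superset R fB BC CB.
move=> /(eqmodXM (eqmodX_refl N.+1 ((1 - 'X) ^+ #|E|))) /eqmodX_trans; apply.
rewrite /B fsbig_image; last by move=> a b _ _; apply: Finj.
have -> : \sum_(a \in [set a | Delta (flow_support (F a))]) ('X^(flow_size (F a)) : {poly R})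
   = \sum_(a | Delta (flow_support (F a))) 'X^(flow_size (F a)).
  rewrite (bigfs _ (P := fun a => Delta (flow_support (F a)))) ?index_enum_uniq //.
  by move=> a _; rewrite mem_index_enum.
rewrite (partition_big (fun a => flow_support (F a)) Delta) //= mulr_sumr.
apply: eqmodX_sum => S DS.
(* The support condition is a separate condition on each entry, so the sum over the box factors over
   the edges. *)
have -> : \sum_(a | Delta (flow_support (F a)) && (flow_support (F a) == S))
      ('X^(flow_size (F a)) : {poly R})
   = \prod_e \sum_(k < N.+1 | (0 < k)%N == (e \in S)) 'X^k.
  rewrite bigA_distr_big_dep /=; apply: eq_big => [a|a _].
    transitivity (flow_support (F a) == S).
      by case: eqP => [->|]; rewrite ?DS ?andbF.
    apply/eqP/familyP => [aS e|aS].
      by rewrite unfold_in -aS inE ffunE.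
    by apply/setP => e; have := aS e; rewrite unfold_in inE ffunE => /eqP.
  rewrite /flow_size -prodrXr; apply: eq_bigr => e _; by rewrite ffunE.
rewrite -prodr_const -big_split /=; apply: eqmodX_prod => e _.
case: (e \in S).
  rewrite big_mkcond big_ord_recl /= add0r.
  under eq_bigr do rewrite /= exprS.
  rewrite -mulr_sumr mulrCA geometric_sum /eqmodX mulrBr mulr1 -exprS.
  by rewrite addrAC subrr add0r dvdpNr.
rewrite big_mkcond big_ord_recl /= big1 ?addr0 ?expr0 ?mulr1; first exact: eqmodX_refl.
by move=> i _.
Qed.

(** * Lexicographic comparison and canonical flows *)

Fixpoint lex_le (E : Type) (s : seq (E -> nat)) (f g : E) : bool :=
  if s is c :: s' then (c f < c g)%N || ((c f == c g) && lex_le s' f g)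
  else true.

(** Minimise the first key, then recurse among its minimisers with the remaining keys. *)
Lemma lex_le_min (E : Type) (s : seq (E -> nat)) (P : E -> Prop) :
  (exists f, P f) -> exists2 f, P f & forall g, P g -> lex_le s f g.
Proof.
elim: s P => [|c s IH] P [f0 Pf0]; first by exists f0.
pose Q n := `[< exists2 f, P f & c f = n >].
have exQ : exists n, Q n by exists (c f0); apply/asboolP; exists f0.
case: (ex_minnP exQ) => n /asboolP[f1 Pf1 cf1] nmin.
have [|f [Pf cf] fmin] := IH (fun f => P f /\ c f = n); first by exists f1.
exists f => // g Pg /=; have ng : (n <= c g)%N by apply: nmin; apply/asboolP; exists g.
have [//|gf] := ltnP (c f) (c g).
have E1 : c g = n by apply/eqP; rewrite eqn_leq ng -cf gf.
by rewrite cf E1 eqxx fmin.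
Qed.

Section CanonicalFlow.
Variable G : sgraph.
Implicit Types f g h : {ffun G * G -> nat}.

(** The size comes first, so that minimal flows realise the norm; the individual entries follow, so
    that the order is antisymmetric. *)
Let keys : seq ({ffun G * G -> nat} -> nat) :=
  (@flow_size _) :: [seq (fun f : {ffun G * G -> nat} => f e) | e <- enum {: G * G}].

Let addf f g : {ffun G * G -> nat} := [ffun e => (f e + g e)%N].
Let mulf k f : {ffun G * G -> nat} := [ffun e => (k * f e)%N].

Lemma flow_sizeD f g : flow_size (addf f g) = (flow_size f + flow_size g)%N.
Proof. by rewrite /flow_size -big_split; apply: eq_bigr => e _; rewrite ffunE. Qed.

Let additive (c : {ffun G * G -> nat} -> nat) := forall f g, c (addf f g) = (c f + c g)%N.

(** All keys are additive, which makes the order compatible with addition and cancellation of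
    flows. *)
Lemma keys_ind (P : seq ({ffun G * G -> nat} -> nat) -> Prop) :
  P [::] -> (forall c s, additive c -> P s -> P (c :: s)) -> P keys.
Proof.
move=> P0 PS; apply: (PS); first exact: flow_sizeD.
elim: (enum _) => //= e s IH; apply: PS => // f g; exact: ffunE.
Qed.

Lemma lex_leD f g f' g' :
  lex_le keys f g -> lex_le keys f' g' -> lex_le keys (addf f f') (addf g g').
Proof.
apply: (keys_ind (P := fun s => lex_le s f g -> lex_le s f' g' ->
                        lex_le s (addf f f') (addf g g'))) => //.
move=> c s cD IH /= /orP[h1|/andP[/eqP h1 k1]] /orP[h2|/andP[/eqP h2 k2]];
  rewrite !cD.
- by apply/orP; left; lia.
- by apply/orP; left; lia.
- by apply/orP; left; lia.
- by rewrite h1 h2 eqxx IH ?orbT.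
Qed.

Lemma lex_le_cancel f g h : lex_le keys (addf h f) (addf h g) -> lex_le keys f g.
Proof.
apply: (keys_ind (P := fun s => lex_le s (addf h f) (addf h g) -> lex_le s f g)) => //.
move=> c s cD IH /=; rewrite !cD ltn_add2l eqn_add2l => /orP[->//|/andP[-> /IH ->]].
by rewrite orbT.
Qed.

Lemma lex_le0 f g : (forall e, f e = 0%N) -> lex_le keys f g.
Proof.
move=> f0; have ff : f = addf f f by apply/ffunP => e; rewrite ffunE f0.
apply: (keys_ind (P := fun s => lex_le s f g)) => //= c s cD IH.
have -> : c f = 0%N by have := cD f f; rewrite -ff; lia.
by rewrite IH andbT; case: (c g).
Qed.

Lemma lex_le_anti f g : lex_le keys f g -> lex_le keys g f -> f = g.
Proof.
rewrite /keys /=.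
have [/= lt|/= lt|_ /=] := ltngtP (flow_size f) (flow_size g); rewrite ?andbF //.
move=> fg gf; apply/ffunP => e; have : e \in enum {: G * G} by rewrite mem_enum.
elim: (enum _) fg gf => //= a s IH.
have [|//|E /=] := ltngtP (f a) (g a) => //.
by move=> fg gf; rewrite inE => /orP[/eqP->//|]; apply: IH.
Qed.

Lemma lex_le_size f g : lex_le keys f g -> (flow_size f <= flow_size g)%N.
Proof. by move=> /= /orP[/ltnW|/andP[/eqP-> _]]. Qed.

(* Asking for minimality of all multiples makes the condition depend on the
   support of [f] only. *)
Definition canonical_flow f : Prop :=
  edge_flow f /\
  forall k g, edge_flow g -> flow_sum g = flow_sum f *+ k -> lex_le keys (mulf k f) g.

(** For large [M] the difference [d] of [M] times [f] and [k] times [g] is a flow. A competitor [h]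
    of the multiple of [g] yields the competitor [d + h] of the multiple of [f], and [d] is
    cancelled from the comparison. *)
Lemma canonical_flow_support f g :
  flow_support g \subset flow_support f -> canonical_flow f -> canonical_flow g.
Proof.
move=> /fintype.subsetP gf [ff fmin]; have ge e : (0 < g e -> 0 < f e)%N.
  by move=> h; have := gf e; rewrite !inE h; apply.
split=> [e he|k h hf hg].
  by have := ge e; rewrite ff //; case: (g e) => // n /(_ isT).
(* Where [g e] is positive so is [f e], hence [g e <= flow_size g <= flow_size g * f e]. *)
pose M := (k * flow_size g)%N.
pose d : {ffun G * G -> nat} := [ffun e => (M * f e - k * g e)%N].
have le e : (k * g e <= M * f e)%N.
  have [->|g0] := posnP (g e); first by rewrite muln0.
  rewrite /M -mulnA leq_mul2l; apply/orP; right.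
  by apply: leq_trans (flow_size_ge g e) _; rewrite leq_pmulr // ge.
have dE : mulf M f = addf d (mulf k g).
  by apply/ffunP => e; rewrite !ffunE subnK.
apply: (@lex_le_cancel _ _ d); rewrite -dE; apply: fmin.
  by move=> e he; rewrite !ffunE hf // ff // muln0 sub0n.
rewrite -flow_sumMn -/(mulf M f) dE !flow_sumD hg.
by rewrite -flow_sumMn.
Qed.

(** A lexicographically minimal flow [f] with sum [x] works. A flow for the multiple [k.+1] of [x]
    splits into flows for [x] and for its multiple [k]; these are compared with [f] and, by
    induction, with [k] times [f]. *)
Lemma canonical_flow_exists x : edge_lattice G x ->
  exists2 f, canonical_flow f & flow_sum f = x.
Proof.
move=> [s sw sx].
have [|f [ff fx] fmin] := @lex_le_min _ keys (fun f => edge_flow f /\ flow_sum f = x).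
  by have [f [ff fx _]] := flow_of_word sw; exists f; rewrite fx.
exists f => //; split=> // k; rewrite fx.
elim: k => [|k IH] g gf gx; first by apply: lex_le0 => e; rewrite ffunE.
have [g1 [g1f g1g g1x]] := flow_split gf gx.
pose g2 : {ffun G * G -> nat} := [ffun e => (g e - g1 e)%N].
have gE : g = addf g1 g2 by apply/ffunP => e; rewrite !ffunE subnKC.
have -> : mulf k.+1 f = addf f (mulf k f).
  by apply/ffunP => e; rewrite !ffunE mulSn.
rewrite gE; apply: lex_leD; first by apply: fmin.
apply: IH; first by move=> e he; rewrite ffunE gf.
apply: (addrI x); rewrite -mulrS -gx gE flow_sumD g1x.
by [].
Qed.

Lemma canonical_flow_min f g : canonical_flow f -> edge_flow g ->
  flow_sum g = flow_sum f -> lex_le keys f g.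
Proof.
move=> [_ fmin] gf gE; have := fmin 1%N g gf; rewrite mulr1n => /(_ gE).
by have -> : mulf 1 f = f by apply/ffunP => e; rewrite ffunE mul1n.
Qed.

Lemma canonical_flow_norm f : canonical_flow f ->
  word_norm (flow_sum f) = flow_size f.
Proof.
move=> cf; have [fl le] := word_norm_flow_le cf.1.
apply/eqP; rewrite eqn_leq le /=; have [s [sw sx <-]] := word_normP fl.
have [g [gf gs <-]] := flow_of_word sw.
by apply/lex_le_size/canonical_flow_min => //; rewrite gs.
Qed.

Lemma canonical_flow_bij :
  set_bij [set f | canonical_flow f] (edge_lattice G) (@flow_sum G).
Proof.
split.
- by move=> f /= cf; apply: (word_norm_flow_le cf.1).1.
- move=> f g; rewrite !inE /= => cf cg fg.
  by apply: lex_le_anti; apply: canonical_flow_min => //; [apply: cg.1|apply: cf.1].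
- by move=> x /canonical_flow_exists[f cf fx]; exists f.
Qed.

Lemma graded_finite_lattice : graded_finite (edge_lattice G) (@word_norm G).
Proof.
apply: graded_finite_bij canonical_flow_bij _ (graded_finite_flows _) => f.
exact: canonical_flow_norm.
Qed.

(** Canonical flows biject with the lattice, and being canonical depends on the support only, so
    [gf_support_closed] applies. The polynomial [p] makes divisibility by [1 + 'X] provable inside
    the polynomial ring. *)
Lemma gf_lattice_rational (R : fieldType) :
  exists p : {poly R}, forall N,
    eqmodX N ((1 - 'X) ^+ #|{: G * G}| * gf R (edge_lattice G) (@word_norm G) N) p.
Proof.
(* A support is tested on its indicator flow; two flows with equal support are canonical
   together. *)
pose Delta (S : {set G * G}) := `[< canonical_flow [ffun e => (e \in S : nat)] >].
have CE : [set f | canonical_flow f] = [set f | Delta (flow_support f)].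
  have sE f : flow_support [ffun e => (e \in flow_support f : nat)] = flow_support f.
    by apply/setP => e; rewrite !inE ffunE inE; case: (f e).
  apply/seteqP; split=> f /= => [h|/asboolP h]; first apply/asboolP;
    by apply: canonical_flow_support h; rewrite sE.
exists (\sum_(S | Delta S) \prod_e (if e \in S then 'X else 1 - 'X)) => N.
rewrite (gf_bij _ _ canonical_flow_bij canonical_flow_norm) CE.
exact: gf_support_closed.
Qed.

End CanonicalFlow.

(** * Lattice points of symmetric edge polytopes *)

Definition real_point (R : realType) (V : finType) (x : {ffun V -> int}) :
  {ffun V -> R} := [ffun v => (x v)%:~R].
Arguments real_point : clear implicits.

Lemma real_point_inj (R : realType) (V : finType) : injective (real_point R V).
Proof.
by move=> x y /ffunP xy; apply/ffunP => v; have := xy v; rewrite !ffunE => /intr_inj.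
Qed.

Lemma unit_vecB (R : realType) (V : finType) (v w : V) :
  unit_vec R v - unit_vec R w = real_point R V (edge_vec (v, w)).
Proof.
by apply/ffunP => u; rewrite !ffunE /inc /= rmorphB /= !rmorph_nat.
Qed.

Section LatticePoints.
Variables (R : realType) (G : sgraph).

(** A convex combination scaled by [j] is a real flow of total size [j]. Rounding it with unit costs
    keeps the sum and does not increase the size. *)
Lemma dilate_points_norm (x : {ffun G -> R}) j :
  dilate_points (sym_edge_polytope R G) j x ->
  exists2 z, edge_lattice G z /\ (word_norm z <= j)%N & real_point R G z = x.
Proof.
move=> [[_ [n [p [a [pS a0 a1 ->]]]] <-] xint].
set x' := finfun _ in xint *.
have [r rP] : exists r : 'I_n -> G * G, forall i,
    adj (r i).1 (r i).2 /\ p i = real_point R G (edge_vec (r i)).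
  have ex i : exists e : G * G, adj e.1 e.2 /\ p i = real_point R G (edge_vec e).
    by have [v [w [vw ->]]] := pS i; exists (v, w); rewrite unit_vecB.
  by have [r rP] := boolp.choice ex; exists r.
(* Several generators may choose the same edge, so their weights are accumulated. *)
pose f e := \sum_i (j%:R * a i) *+ (r i == e).
have fsum (F : G * G -> R) : \sum_e f e * F e = \sum_i j%:R * a i * F (r i).
  under eq_bigr do rewrite mulr_suml.
  rewrite exchange_big; apply: eq_bigr => i _.
  rewrite (bigD1 (r i)) //= eqxx big1 ?addr0 // => e.
  by rewrite eq_sym => /negPf ->; rewrite mul0r.
have fx v : \sum_e f e * (inc e v)%:~R = x' v.
  rewrite fsum !ffunE mulr_sumr; apply: eq_bigr => i _.
  by rewrite (rP i).2 !ffunE mulrA.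
have f0 e : 0 <= f e.
  by apply: sumr_ge0 => i _; rewrite mulrn_wge0 // mulr_ge0 // ler0n.
have f1 : \sum_e f e = j%:R.
  transitivity (\sum_e f e * 1); first by under [RHS]eq_bigr do rewrite mulr1.
  by rewrite (fsum (fun=> 1)) -mulr_suml -mulr_sumr a1 !mulr1.
have fadj e : ~~ adj e.1 e.2 -> f e = 0.
  move=> he; rewrite /f big1 // => i _; case: eqP => // ie.
  by rewrite -ie (rP i).1 in he.
have [|||g [gb gx gc]] := @flow_rounding R G (fun=> 1) (fun=> 0)
    (fun e => if adj e.1 e.2 then j%:Z else 0) f.
- move=> e; rewrite f0 /=; case: ifPn => [_|/fadj ->//].
  by rewrite -pmulrn -f1 (bigD1 e) //= lerDl sumr_ge0.
- by move=> v; rewrite fx; apply: xint.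
- move=> e; apply: contraNneq => e12.
  by rewrite fadj ?rpred0 // e12 adj_irr.
have gE e : g e = `|g e|%:Z by rewrite gez0_abs //; have /andP[] := gb e.
pose h : {ffun G * G -> nat} := [ffun e => `|g e|%N].
have hf : edge_flow h.
  move=> e he; have := gb e; rewrite ffunE (negPf he); lia.
have hx : real_point R G (flow_sum h) = x'.
  apply/ffunP => v; rewrite -fx gx ffunE flow_sumE; congr (_%:~R).
  by apply: eq_bigr => e _; rewrite ffunE natz -gE.
exists (flow_sum h) => //; have [hl hn] := word_norm_flow_le hf; split=> //.
apply: leq_trans hn _; rewrite -(ler_nat R) -f1 /flow_size natr_sum.
under eq_bigr do rewrite ffunE -(mulr1 _%:R) mulrC pmulrn -gE.
by rewrite (le_trans gc) //; under eq_bigr do rewrite mul1r.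
Qed.

(** The edge from [v] to [w] makes the polytope nonempty, as the case [j = 0] requires, and supplies
    the padding for the other cases. *)
Lemma norm_dilate_points (z : {ffun G -> int}) j (v w : G) : adj v w ->
  edge_lattice G z -> (word_norm z <= j)%N ->
  dilate_points (sym_edge_polytope R G) j (real_point R G z).
Proof.
move=> vw zl zj; split; last by move=> u; rewrite ffunE intr_int.
have [s [sw sz sn]] := word_normP zl.
case: (posnP j) => [j0|j0].
  exists (unit_vec R v - unit_vec R w).
    exists 1%N, (fun=> unit_vec R v - unit_vec R w), (fun=> 1); split=> //.
    - by move=> _; exists v, w.
    - by rewrite big_ord1.
    - by apply/ffunP => u; rewrite ffunE big_ord1 mul1r.
  have s0 : s = [::] by apply: size0nil; lia.
  by apply/ffunP => u; rewrite !ffunE -sz s0 word_sum_nil ffunE j0 mul0r.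
(* Doubling the word lets us pad it to length [2 j] with cancelling pairs. *)
pose m := (j - size s)%N.
pose t := (s ++ s) ++ (nseq m (v, w) ++ nseq m (w, v)).
have tn : size t = j.*2 by rewrite !size_cat !size_nseq /m; lia.
have tw : edge_word t.
  rewrite /edge_word !all_cat !all_nseq /= vw adj_sym vw !orbT !andbT.
  by apply/andP.
have tz : word_sum t = z + z.
  rewrite !word_sum_cat sz /word_sum !big_nseq !iter_addr_0.
  by rewrite -[(w, v)]/((v, w).2, (v, w).1) edge_vec_swap mulNrn subrr addr0.
have j2 : j.*2%:R != 0 :> R by rewrite pnatr_eq0; lia.
pose e0 := (v, w).
have sumt (F : G * G -> R) : \sum_(i < size t) F (nth e0 t i) = \sum_(e <- t) F e.
  by rewrite (big_nth e0) big_mkord.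
(* The barycentre of the [2 j] letters of [t], each with weight [1 / (2 j)]. *)
exists [ffun u => (j.*2%:R)^-1 * (z u + z u)%:~R].
  exists (size t), (fun i => real_point R G (edge_vec (nth e0 t i))), (fun=> (j.*2%:R)^-1).
  split.
  - move=> i; exists (nth e0 t i).1, (nth e0 t i).2.
    split; last by rewrite unit_vecB -surjective_pairing.
    by have /allP := tw; apply; rewrite mem_nth.
  - by move=> _; rewrite invr_ge0 ler0n.
  - by rewrite sumr_const card_ord tn -[_ *+ _]mulr_natl divff.
  - apply/ffunP => u; rewrite !ffunE -mulr_sumr; congr (_ * _).
    rewrite (sumt (fun e => real_point R G (edge_vec e) u)).
    have <- : word_sum t u = z u + z u by rewrite tz ffunE.
    by rewrite /word_sum sum_ffunE rmorph_sum; apply: eq_bigr => e _; rewrite !ffunE.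
apply/ffunP => u; rewrite !ffunE intrD -muln2 natrM.
have : j%:R != 0 :> R by rewrite pnatr_eq0 -lt0n.
move: (j%:R : R) ((z u)%:~R : R) => c d c0; field.
by rewrite c0.
Qed.

Lemma ehrhart_norm (v w : G) j : adj v w ->
  ehrhart (sym_edge_polytope R G) j =
  #|` fset_set (edge_lattice G `&` [set z | (word_norm z <= j)%N])|.
Proof.
move=> vw; rewrite /ehrhart.
have -> : dilate_points (sym_edge_polytope R G) j =
    real_point R G @` (edge_lattice G `&` [set z | (word_norm z <= j)%N]).
  apply/seteqP; split=> [x /dilate_points_norm[z zj <-]|_ [z [zl zj] <-]].
    by exists z.
  exact: norm_dilate_points vw zl zj.
rewrite fset_set_image; last exact: (graded_finite_lattice G j.+1).
by rewrite card_imfset //; apply: real_point_inj.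
Qed.

(** By [ehrhart_norm] and [gf_cumulative] the Ehrhart series is the norm series divided by [1 - t],
    which absorbs one of the factors in [is_hstar]. *)
Lemma sep_hstarP (v w : G) (h : {poly R}) : adj v w ->
  is_sep_hstar G h <->
  forall N, eqmodX N h ((1 - 'X) ^+ #|G|.-1 * gf R (edge_lattice G) (@word_norm G) N).
Proof.
move=> vw; pose P N : {poly R} := \poly_(j < N) (ehrhart (sym_edge_polytope R G) j)%:R.
have step N : eqmodX N ((1 - 'X) ^+ #|G|.-1.+1 * P N)
    ((1 - 'X) ^+ #|G|.-1 * gf R (edge_lattice G) (@word_norm G) N).
  rewrite exprSr -mulrA; apply: eqmodXM; first exact: eqmodX_refl.
  rewrite /P; under eq_poly do rewrite (ehrhart_norm _ vw).
  exact/gf_cumulative/graded_finite_lattice.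
have coefP N n : (n < N)%N -> ((1 - 'X) ^+ #|G|.-1.+1 * P N)`_n =
    \sum_(i < n.+1) ((1 - 'X) ^+ #|G|.-1.+1 : {poly R})`_i
       * (ehrhart (sym_edge_polytope R G) (n - i))%:R.
  move=> nN; rewrite coefM; apply: eq_bigr => i _; rewrite coef_poly.
  by rewrite (leq_ltn_trans (leq_subr _ _) nN).
split=> [hh N|hh n].
  apply: eqmodX_trans (step N); apply/eqmodX_coef => n nN.
  by rewrite coefP //; apply: hh.
rewrite -(coefP n.+1) //.
by apply: (eqmodX_coef _ _ _ (eqmodX_trans (hh n.+1) (eqmodX_sym (step n.+1)))).
Qed.

End LatticePoints.

(** * Generating functions of glued graphs *)

Lemma graded_finite_int : graded_finite [set: int] (fun k => `|k|%N).
Proof.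
move=> N; apply: (@sub_finite_set _ _ (Posz @` `I_N `|` Negz @` `I_N)).
  by move=> [n|n] [_ /= h]; [left|right]; exists n => //=; lia.
by rewrite finite_setU; split; apply/finite_image/finite_II.
Qed.

Lemma graded_finite_reduced (G : sgraph) (e : G * G) :
  graded_finite (edge_reduced e) (@word_norm G).
Proof.
move=> N; apply: sub_finite_set (graded_finite_lattice G N).
by move=> y [[yl _ _] yN].
Qed.

(** A lattice vector is uniquely a reduced [y] plus [k] times the edge vector, of norm
    [word_norm y + |k|]; the sum over [k] is [gf_int]. *)
Lemma gf_bipartite (R : fieldType) (G : sgraph) (e : G * G) N :
  sgraph_bipartite G -> adj e.1 e.2 ->
  eqmodX N ((1 - 'X) * gf R (edge_lattice G) (@word_norm G) N)
           ((1 + 'X) * gf R (edge_reduced e) (@word_norm G) N).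
Proof.
move=> bipG he.
have bij : set_bij (edge_reduced e `*` [set: int]) (edge_lattice G)
    (fun p => p.1 + edge_vec e *~ p.2).
  split.
  - move=> [y k] [/= [yl _ _] _]; apply: edge_latticeD => //.
    exact/edge_latticeMz/edge_lattice_edge.
  - move=> [y k] [y' k']; rewrite !inE => -[/= ry _] [/= ry' _] E.
    have yE : y' = y + edge_vec e *~ (k - k').
      by rewrite mulrzBr addrA E addrK.
    have /eqP := edge_reduced_uniq he ry (eq_ind _ (edge_reduced e) ry' _ yE).
    by rewrite subr_eq0 => /eqP kk'; rewrite yE kk' subrr mulr0z addr0.
  - move=> x xl; have [k rk] := edge_reduced_exists he bipG xl.
    exists (x + edge_vec e *~ k, - k) => //=.
    by rewrite mulrNz addrK.
rewrite (@gf_bij R _ _ _ _ (fun p => word_norm p.1 + `|p.2|)%N _ _ N bij); last first.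
  by move=> [y k] [/= ry _]; apply: edge_reduced_norm.
apply: eqmodX_trans (eqmodXM (eqmodX_refl _ _) (eqmodX_sym (gf_prod R N
  (@graded_finite_reduced G e) graded_finite_int))) _.
rewrite mulrCA mulrC; apply: eqmodXM; last exact: eqmodX_refl.
exact: gf_int.
Qed.

Lemma gf_gluing (R : fieldType) (G1 G2 G : sgraph) (v1 w1 : G1) (v2 w2 : G2)
    (pi : G1 + G2 -> G) N :
  sgraph_bipartite G2 -> adj v1 w1 -> adj v2 w2 -> edge_gluing v1 w1 v2 w2 pi ->
  eqmodX N (gf R (edge_lattice G) (@word_norm G) N)
    (gf R (edge_lattice G1) (@word_norm G1) N
     * gf R (edge_reduced (v2, w2)) (@word_norm G2) N).
Proof.
move=> bip2 adj1 adj2 glue.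
pose h (p : {ffun G1 -> int} * {ffun G2 -> int}) :=
  pushforward (fun u => pi (inl u)) p.1 + pushforward (fun u => pi (inr u)) p.2.
have bij : set_bij (edge_lattice G1 `*` edge_reduced (v2, w2)) (edge_lattice G) h.
  split.
  - by move=> [x y] [/= xl ry]; apply: (gluing_norm adj1 adj2 glue xl ry).1.
  - move=> [x y] [x' y']; rewrite !inE => -[/= _ ry] [/= _ ry'].
    by move=> /(gluing_inj adj2 glue ry ry')[/= -> ->].
  - move=> z /(gluing_surj bip2 adj1 adj2 glue)[x [y [xl ry zE]]].
    by exists (x, y).
rewrite (@gf_bij R _ _ _ _ (fun p => word_norm p.1 + word_norm p.2)%N _ h N bij); last first.
  by move=> [x y] [/= xl ry]; apply: (gluing_norm adj1 adj2 glue xl ry).2.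
apply: eqmodX_sym; apply: gf_prod; first exact: graded_finite_lattice.
exact: graded_finite_reduced.
Qed.

(** Allows cancelling [1 + 'X] in a congruence modulo ['X^N]. *)
Lemma coprime_1DX_Xn (R : fieldType) N : coprimep (1 + 'X : {poly R}) 'X^N.
Proof.
rewrite coprimep_expr // -['X]subr0 -[0]/(0%:P) coprimep_XsubC /root.
by rewrite subr0 !hornerE oner_eq0.
Qed.

Lemma coprime_1DX_1BX (R : numFieldType) m :
  coprimep (1 + 'X : {poly R}) ((1 - 'X) ^+ m).
Proof.
rewrite coprimep_expr // -opprB -scaleN1r coprimepZr ?oppr_eq0 ?oner_eq0 //.
by rewrite -[X in 'X - X]polyC1 coprimep_XsubC /root !hornerE -(natrD _ 1 1) pnatr_eq0.
Qed.

(** The divisibility in the first conjunct says that the Euclidean quotient in the other two is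
    exact. *)
Theorem theorem4p17 (R : realType) (G1 G2 G : sgraph)
    (v1 w1 : G1) (v2 w2 : G2) (pi : G1 + G2 -> G) (H1 H2 : {poly R}) :
  sgraph_connected G1 ->
  sgraph_connected G2 -> sgraph_bipartite G2 ->
  is_sep_hstar G1 H1 -> is_sep_hstar G2 H2 ->
  adj v1 w1 -> adj v2 w2 -> edge_gluing v1 w1 v2 w2 pi ->
  [/\ (1 + 'X %| H1 * H2)%R,
      is_sep_hstar G ((H1 * H2) %/ (1 + 'X))
    & real_rooted H1 -> real_rooted H2 ->
      real_rooted ((H1 * H2) %/ (1 + 'X))].
Proof.
move=> _ _ bip2 hH1 hH2 adj1 adj2 glue.
have adjG := gluing_adj_inl glue adj1.
pose A := gf R (edge_lattice G) (@word_norm G).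
(* The claimed identity multiplied by [1 + t], at the level of power series. *)
have key N : eqmodX N (H1 * H2) ((1 + 'X) * ((1 - 'X) ^+ #|G|.-1 * A N)).
  have h1 := (sep_hstarP H1 adj1).1 hH1 N.
  have h2 := (sep_hstarP H2 adj2).1 hH2 N.
  apply: eqmodX_trans (eqmodXM h1 h2) _.
  have hb := @gf_bipartite R G2 (v2, w2) N bip2 adj2.
  have hg := gf_gluing R N bip2 adj1 adj2 glue.
  set A1 := gf R (edge_lattice G1) _ N in h1 hg *.
  set A2 := gf R (edge_lattice G2) _ N in h2 hb *.
  set B := gf R (edge_reduced _) _ N in hb hg.
  (* The dimensions of the two polytopes add up to one more than that of the glued one; the spare
     factor [1 - 'X] is consumed by [gf_bipartite]. *)
  have [d1 [d2 [-> -> ->]]] : exists d1 d2,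
      [/\ #|G1|.-1 = d1, #|G2|.-1 = d2.+1 & #|G|.-1 = (d1 + d2)%N].
    have c1 : (0 < #|G1|)%N by apply/card_gt0P; exists v1.
    have c2 : (1 < #|G2|)%N.
      apply/card_gt1P; exists v2, w2; split=> //.
      by apply: contraTneq adj2 => ->; rewrite adj_irr.
    have := gluing_card adj2 glue.
    by exists #|G1|.-1, #|G2|.-2; split; lia.
  apply: (@eqmodX_trans _ _ _ ((1 - 'X) ^+ (d1 + d2) * A1 * ((1 + 'X) * B))).
    have -> : (1 - 'X) ^+ d1 * A1 * ((1 - 'X) ^+ d2.+1 * A2) =
              (1 - 'X) ^+ (d1 + d2) * A1 * ((1 - 'X) * A2).
      by rewrite exprD exprS; ring.
    by apply: eqmodXM hb; apply: eqmodX_refl.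
  have -> : (1 - 'X) ^+ (d1 + d2) * A1 * ((1 + 'X) * B) =
            (1 + 'X) * ((1 - 'X) ^+ (d1 + d2) * (A1 * B)) by ring.
  by do 2!(apply: eqmodXM; first exact: eqmodX_refl); apply: eqmodX_sym.
have [p hp] := gf_lattice_rational G R.
set m := #|_| in hp.
(* After multiplication by [(1 - 'X) ^+ m], which is coprime to [1 + 'X], both sides of [key] are
   polynomials independent of [N], so the congruences become an equality. *)
have dvd : (1 + 'X %| H1 * H2)%R.
  rewrite -(Gauss_dvdpr _ (coprime_1DX_1BX R m)).
  have -> : (1 - 'X) ^+ m * (H1 * H2) = (1 + 'X) * ((1 - 'X) ^+ #|G|.-1 * p).
    apply: eqmodX_eq => N.
    apply: eqmodX_trans (eqmodXM (eqmodX_refl _ _) (key N)) _.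
    rewrite mulrCA; apply: eqmodXM; first exact: eqmodX_refl.
    rewrite mulrCA; apply: eqmodXM; first exact: eqmodX_refl.
    exact: hp.
  exact: dvdp_mulr.
have HE := divpK dvd; move: HE; set Q := _ %/ _ => HE.
split=> //.
  apply/(sep_hstarP _ adjG) => N; have := key N.
  rewrite -HE mulrC /eqmodX -mulrBr Gauss_dvdpr //.
  by rewrite coprimep_sym coprime_1DX_Xn.
(* A root of the quotient is a root of the product, hence of [H1] or [H2]. *)
move=> r1 r2 z rz.
have : root (map_poly (real_complex R) (H1 * H2)) z.
  by rewrite -HE rmorphM /= rootM rz.
by rewrite rmorphM /= rootM => /orP[/r1|/r2].
Qed.
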